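(* Let $M$ be a closed orientable 3-manifold equipped with a $\mathrm{Nil}$ geometry. Then no Legendrian map $f:M\to M$ is a diffeomorphism.
   Context: $M$ is a (connected) quotient of the Nil space by a discrete group of orientation-preserving isometries acting freely, with the induced Riemannian metric. Nil is $\mathbb{R}^3$ with group law $(x,y,z)\cdot(x',y',z')=(x+x',y+y',z+z'+xy')$ and the left-invariant metric for which $\partial_x,\ \partial_y+x\partial_z,\ \partial_z$ are orthonormal. The line field spanned by $\partial_z$ and the plane field spanned by $\partial_x,\ \partial_y+x\partial_z$ are invariant under orientation-preserving isometries and descend to a line field $\mathcal V$ (tangent to the circle fibers of the Seifert fibration of $M$) and to the orthogonal contact plane field $\mathcal D$ on $M$. A smooth map $f:M\to M$ is called Legendrian if $f$ is homotopic to the identity and $f_*(\mathcal V_x)\subset\mathcal D_{f(x)}$ for all $x\in M$. *)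

(* Defs.v *)
From HB Require Import structures.
From mathcomp Require Import all_boot all_order all_algebra generic_quotient.
From mathcomp Require Import all_classical all_reals all_analysis.
From mathcomp Require Import ring.
Set Implicit Arguments.
Unset Strict Implicit.
Unset Printing Implicit Defensive.
Import Order.TTheory GRing.Theory Num.Theory.
Import numFieldNormedType.Exports.
Local Open Scope classical_set_scope.
Local Open Scope ring_scope.

(** * Smooth maps between open subsets of normed spaces *)

(* [f] is C^n on [U]. This is the usual notion only when [U] is open. *)
Fixpoint Cn (R : realType) (V W : normedModType R) (n : nat) (U : set V)
    (f : V -> W) : Prop :=
  match n with
  | 0%N => forall x, U x -> {for x, continuous f}
  | m.+1 => (forall x, U x -> differentiable f x) /\
            (forall v : V, Cn m U (fun x => 'D_v f x))
  end.

Definition smooth_on (R : realType) (V W : normedModType R) (U : set V)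
  (f : V -> W) : Prop := forall n, Cn n U f.

(** * Homotopy *)

Definition homotopic (R : realType) (X Y : topologicalType) (f g : X -> Y)
    : Prop :=
  exists H : R * X -> Y,
    [/\ {within `[0%R, 1%R] `*` [set: X], continuous H},
        forall x, H (0, x) = f x &
        forall x, H (1, x) = g x].

(** * Groups of transformations and their orbit spaces *)

Record transf_group (T : Type) := TransfGroup {
  transf :> (T -> T) -> Prop;
  transf_id : transf id;
  transf_comp : forall g h, transf g -> transf h -> transf (g \o h);
  transf_inv : forall g, transf g ->
    exists h, [/\ transf h, cancel g h & cancel h g] }.

Definition acts_freely (T : Type) (G : transf_group T) : Prop :=
  forall g p, G g -> g p = p -> g = id.

(* Discreteness as a subset of the space of maps with the compact-open topology,
   which is the topology of the isometry group of a Riemannian manifold. *)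
Definition discrete_group (T : topologicalType) (G : transf_group T) : Prop :=
  let S : set {compact-open, T -> T} := transf G in S `<=` isolated S.

Definition orbit_rel (T : choiceType) (G : transf_group T) : rel T :=
  fun p q => `[< exists2 g, G g & g p = q >].

Lemma orbit_rel_equiv (T : choiceType) (G : transf_group T) :
  equiv_class_of (orbit_rel G).
Proof.
have sym : forall p q, orbit_rel G p q -> orbit_rel G q p.
  move=> p q /asboolP[g Gg <-]; apply/asboolP.
  by have [h [Gh gK _]] := transf_inv Gg; exists h.
split.
- by move=> p; apply/asboolP; exists id => //; exact: transf_id.
- by move=> p q; apply/idP/idP; exact: sym.
- move=> q p r /asboolP[g Gg <-] /asboolP[h Gh <-]; apply/asboolP.
  by exists (h \o g) => //; exact: transf_comp.
Qed.

Definition orbit_equiv (T : choiceType) (G : transf_group T) : equiv_rel T :=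
  EquivRelPack (orbit_rel_equiv G).

Definition orbit_space (T : topologicalType) (G : transf_group T) : Type :=
  quotient_topology {eq_quot (orbit_equiv G)}%qT.

HB.instance Definition _ (T : topologicalType) (G : transf_group T) :=
  Topological.on (orbit_space G).

Definition orbit_pi (T : topologicalType) (G : transf_group T) (p : T) :
  orbit_space G := (\pi_({eq_quot (orbit_equiv G)}) p)%qT.

Lemma orbit_piP (T : topologicalType) (G : transf_group T) (p q : T) :
  orbit_pi G p = orbit_pi G q <-> exists2 g, G g & g p = q.
Proof.
split; first by move=> /eqmodP /asboolP.
by move=> h; apply/eqmodP/asboolP.
Qed.

(** * The Nil space *)

Lemma diff_affine (R : realType) (V W : normedModType R) (B : {linear V -> W})
    (c : W) (q v : V) : continuous B ->
  differentiable (fun x => c + B x) q /\ 'd (fun x => c + B x) q v = B v.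
Proof.
move=> cB; have dB : differentiable B q by exact: linear_differentiable.
have dc : differentiable (cst c : V -> W) q by exact: differentiable_cst.
rewrite (_ : (fun x => c + B x) = cst c + B) //; split.
  exact: differentiableD.
by rewrite (diffD dc dB) (diff_lin q cB) diff_cst /= add0r.
Qed.

Section Nil.
Variable R : realType.
Local Notation V := 'rV[R]_3.
Implicit Types p q u v : V.

Definition vec3 (a b c : R) : V := \row_(i < 3) [:: a; b; c]`_i.

Definition nil_mul p q : V :=
  vec3 (p 0 0 + q 0 0) (p 0 1 + q 0 1) (p 0 2 + q 0 2 + p 0 0 * q 0 1).

(* The frame [d/dx], [d/dy + x d/dz], [d/dz] at [p]. *)
Definition nil_frame p : 'I_3 -> V :=
  fun i => [:: vec3 1 0 0; vec3 0 1 (p 0 0); vec3 0 0 1]`_i.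

(* [dx^2 + dy^2 + (dz - x dy)^2] *)
Definition nil_metric p u v : R :=
  u 0 0 * v 0 0 + u 0 1 * v 0 1 +
  (u 0 2 - p 0 0 * u 0 1) * (v 0 2 - p 0 0 * v 0 1).

Lemma vec3E0 a b c : vec3 a b c 0 0 = a. Proof. by rewrite mxE. Qed.
Lemma vec3E1 a b c : vec3 a b c 0 1 = b. Proof. by rewrite mxE. Qed.
Lemma vec3E2 a b c : vec3 a b c 0 2 = c. Proof. by rewrite mxE. Qed.
Definition vec3E := (vec3E0, vec3E1, vec3E2).

Lemma vec3_eq u v : u 0 0 = v 0 0 -> u 0 1 = v 0 1 -> u 0 2 = v 0 2 -> u = v.
Proof.
move=> h0 h1 h2; apply/rowP; case=> [[|[|[|//]]] i].
- by rewrite (_ : Ordinal i = 0) //; exact: val_inj.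
- by rewrite (_ : Ordinal i = 1) //; exact: val_inj.
- by rewrite (_ : Ordinal i = 2) //; exact: val_inj.
Qed.

Lemma nil_metric_frame p (i j : 'I_3) :
  nil_metric p (nil_frame p i) (nil_frame p j) = (i == j)%:R.
Proof.
by case: i j => [[|[|[|//]]] i] [[|[|[|//]]] j];
  rewrite /nil_metric /nil_frame /= !vec3E /eq_op /=; ring.
Qed.

Lemma nil_mul_diff p q v :
  differentiable (nil_mul p) q /\
  'd (nil_mul p) q v = vec3 (v 0 0) (v 0 1) (v 0 2 + p 0 0 * v 0 1).
Proof.
pose A : 'M[R]_3 := 1%:M + p 0 0 *: delta_mx 1 2.
have AE u : u *m A = vec3 (u 0 0) (u 0 1) (u 0 2 + p 0 0 * u 0 1).
  rewrite mulmxDr mulmx1 -scalemxAr.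
  have dE (j : 'I_3) : (u *m delta_mx 1 2 : V) 0 j = u 0 1 * (j == 2)%:R.
    rewrite mxE (bigD1 1) //= big1 ?addr0 ?mxE ?eqxx //.
    by move=> k /negPf k1; rewrite mxE k1 mulr0.
  by apply: vec3_eq; rewrite mxE [X in _ + X]mxE dE !mxE /=; ring.
have [B BE] : exists B : {linear V -> V}, forall u, B u = u *m A.
  by exists (mulmxr A).
have {A AE}BE u : B u = vec3 (u 0 0) (u 0 1) (u 0 2 + p 0 0 * u 0 1).
  by rewrite BE AE.
have mulE : nil_mul p = fun u => p + B u.
  apply/funext => u; rewrite BE.
  by apply: vec3_eq; rewrite !mxE /=; ring.
have cB : continuous B.
  have -> : (B : V -> V) = fun u => u + (p 0 0 * u 0 1) *: vec3 0 0 1.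
    by apply/funext => u; rewrite BE; apply: vec3_eq; rewrite !mxE /=; ring.
  move=> u; apply: (@cvgD _ _ _ (nbhs u) _ id); first exact: cvg_id.
  apply: (@cvgZr_tmp _ _ _ _ _ (fun w : V => p 0 0 * w 0 1)).
  by apply: cvgMl_tmp; exact: coord_continuous.
rewrite mulE; have [dB ->] := diff_affine p q v cB.
by split; rewrite ?BE.
Qed.

Lemma nil_frame_left_invariant p q i :
  'd (nil_mul p) q (nil_frame q i) = nil_frame (nil_mul p q) i.
Proof.
rewrite (nil_mul_diff p q _).2.
by case: i => [[|[|[|//]]] i]; apply: vec3_eq; rewrite /nil_frame !vec3E /=; ring.
Qed.

Definition nil_isometry (g : V -> V) : Prop :=
  [/\ smooth_on setT g,
      (exists h : V -> V, [/\ smooth_on setT h, cancel g h & cancel h g]) &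
      forall p u v, nil_metric (g p) ('d g p u) ('d g p v) = nil_metric p u v].

Definition orientation_preserving (g : V -> V) : Prop :=
  forall p, 0 < \det ('J g p).

(* These are invariant under orientation-preserving isometries; their images
   under the projection are the line field tangent to the Seifert fibration of
   the quotient and the orthogonal contact plane field. *)
Definition vertical_line p : set V :=
  [set v | exists c, v = c *: nil_frame p 2].

Definition contact_plane p : set V :=
  [set v | exists a b, v = a *: nil_frame p 0 + b *: nil_frame p 1].

End Nil.

(** * Maps of a quotient of Nil *)

Section Quotient.
Variables (R : realType) (G : transf_group 'rV[R]_3).
Local Notation V := 'rV[R]_3.
Local Notation M := (orbit_space G).
Implicit Types f : M -> M.

(* The charts of [M] are the local inverses of [orbit_pi G], so these are the
   expressions of [f] in charts. *)
Definition local_lift f (U : set V) (F : V -> V) : Prop :=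
  [/\ open U, smooth_on U F &
      forall p, U p -> orbit_pi G (F p) = f (orbit_pi G p)].

Definition smooth_map f : Prop :=
  forall p, exists U F, U p /\ local_lift f U F.

Definition diffeomorphism f : Prop :=
  smooth_map f /\
  exists g : M -> M, [/\ smooth_map g, cancel f g & cancel g f].

(* [f_*] maps the class of the tangent vector [v] at [p] to the class of the
   tangent vector ['d F p v] at [F p]. *)
Definition legendrian f : Prop :=
  [/\ smooth_map f, homotopic R f id &
      forall U F p, local_lift f U F -> U p ->
        'd F p @` vertical_line p `<=` contact_plane (F p)].

End Quotient.

(* Main.v *)
(** Put [alpha = dz - x dy], so that the contact plane field is [ker alpha], and
let [X, Y, Z] be the left-invariant frame. For a local lift [F] of a Legendrian
map, [beta = F^*alpha] vanishes on [Z]; write [a = beta(X)] and [b = beta(Y)].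
Then [a * Z b - b * Z a] is the Jacobian determinant of [F], so for a
diffeomorphism the angle [theta] of [(a, b)] turns strictly monotonically along
vertical lines.

Isometries preserve [alpha] up to sign: Koszul's formula for an orientation
preserving isometry [g] shows that the components of [g^*alpha] in the moving
frame are constant along [X] and [Y], hence constant since [[X, Y] = Z], and
then that [g^*alpha] is [alpha] or [- alpha]. They also act on [(X, Y)] by a
constant orthogonal matrix. So [(a + i b)^2] does not depend on the lift,
twice its angle form is globally defined on Nil, and [|X theta|^2 + |Y theta|^2]
and [|Z theta|] are functions on the compact quotient: the former is bounded
and the latter is bounded below by some [eps > 0]. The path with sides of
length [s] along [X, Y, - X, - Y] closes up to a vertical translation by
[s ^ 2], so [eps * s ^ 2 <= O(s)], which is absurd for large [s]. *)

Require Import Defs.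
From mathcomp Require Import all_boot all_order all_algebra.
From mathcomp Require Import all_classical all_reals all_analysis.
From mathcomp Require Import ring lra.
Set Implicit Arguments.
Unset Strict Implicit.
Unset Printing Implicit Defensive.
Import Order.TTheory GRing.Theory Num.Theory.
Import numFieldNormedType.Exports.
Local Open Scope classical_set_scope.
Local Open Scope ring_scope.

(** * Calculus along lines *)

(** The map [f] is visible only through local lifts, so each quantity built from a lift must be
    shown not to depend on it. Two lifts differ locally by one element of [G], provided each point
    has a neighbourhood disjoint from its translates by nontrivial elements. Discreteness is given
    in the compact-open topology; the bridge is an explicit form of the isometries as polynomial
    maps with six real parameters, where bounded parameter sets are relatively compact.

    The Jacobian enters through the structure equation [d beta = F^* (d alpha)] with
    [d alpha = - dx /\ dy]: evaluated on [(Z, X)] and [(Z, Y)], where [beta(Z) = 0] removes all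
    terms but one on the left, it expresses [Z a] and [Z b] as minors of the differential.

    A branch of the angle is built on boxes only, by adding arctangents along rays from the origin.
    This suffices because the bounds fix the side length [s], and [s] fixes a box containing the
    whole path. *)

Lemma nbhsS (T : topologicalType) (p : T) (A B : set T) :
  A `<=` B -> nbhs p A -> nbhs p B.
Proof. exact: filterS. Qed.

Lemma nbhsI (T : topologicalType) (p : T) (A B : set T) :
  nbhs p A -> nbhs p B -> nbhs p (A `&` B).
Proof. exact: filterI. Qed.

Section Lines.
Variables (R : realType) (V : normedModType R).
Implicit Types (h : V -> R) (p u v : V) (s t : R).

Lemma is_derive_line h p v t (d : R) :
  is_derive (p + t *: v) v h d -> is_derive t 1 (fun x => h (p + x *: v)) d.
Proof.
move=> [dh <-].
have E : (fun x : R => x^-1 *: (((fun y => h (p + y *: v)) \o shift t) (x *: (1 : R)) -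
    h (p + t *: v))) =
    (fun x : R => x^-1 *: ((h \o shift (p + t *: v)) (x *: v) - h (p + t *: v))).
  apply/funext => x /=; congr (_ *: (h _ - _)).
  by rewrite [x *: 1]mulr1 scalerDl addrCA.
by split; rewrite /derivable /derive E.
Qed.

Lemma mvt_line h p v (d : R -> R) s : 0 <= s ->
  (forall t, 0 <= t <= s -> is_derive (p + t *: v) v h (d t)) ->
  exists2 c, 0 <= c <= s & h (p + s *: v) - h p = d c * s.
Proof.
move=> s0 hd.
have [||c cs e] := @MVT_segment R (fun x => h (p + x *: v)) d 0 s s0.
- move=> x; rewrite in_itv /= => /andP[x0 xs].
  by apply: is_derive_line; apply: hd; rewrite !ltW.
- apply: derivable_within_continuous => x; rewrite in_itv /= => xs.
  by have /is_derive_line[] := hd _ xs.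
- exists c; first by move: cs; rewrite in_itv.
  by move: e; rewrite scale0r addr0 subr0.
Qed.

Lemma nbhs_parallelogram (W : set V) p u v : nbhs p W ->
  exists2 s, 0 < s & forall x y, 0 <= x <= s -> 0 <= y <= s ->
    W (p + x *: u + y *: v).
Proof.
move=> /nbhs_ballP[e /= e0 We].
(* The summand 1 keeps [m] positive even when [u] and [v] vanish. *)
pose m := `|u| + `|v| + 1.
have m0 : 0 < m by rewrite ltr_wpDl // addr_ge0.
exists (e / m); first by rewrite divr_gt0.
move=> x y /andP[x0 xs] /andP[y0 ys]; apply: We.
rewrite -ball_normE /ball_ /= -addrA opprD addrA subrr sub0r normrN.
apply: le_lt_trans (ler_normD _ _) _; rewrite !normrZ !ger0_norm //.
have : x * `|u| + y * `|v| <= (e / m) * (`|u| + `|v|).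
  by rewrite mulrDr lerD // ler_wpM2r.
move=> /le_lt_trans; apply.
by rewrite -[ltRHS](@divfK _ m) ?gt_eqF // ltr_pM2l ?divr_gt0 // ltrDl.
Qed.

Lemma second_difference (U : set V) h p u v s : 0 <= s ->
  (forall x, U x -> derivable h x u) ->
  (forall x, U x -> derivable ('D_u h) x v) ->
  (forall x y, 0 <= x <= s -> 0 <= y <= s -> U (p + x *: u + y *: v)) ->
  exists x y, [/\ 0 <= x <= s, 0 <= y <= s &
    h (p + s *: u + s *: v) - h (p + s *: u) - h (p + s *: v) + h p =
    'D_v ('D_u h) (p + x *: u + y *: v) * s * s].
Proof.
move=> s0 dh ddh Us.
have ss : 0 <= s <= s by rewrite s0 /=.
have oo : (0 : R) <= 0 <= s by apply/andP; split.
have U0 x : 0 <= x <= s -> U (p + x *: u).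
  by move=> xs; have := Us x 0 xs oo; rewrite scale0r addr0.
have [x xs ex] : exists2 x, 0 <= x <= s &
    (h (p + s *: v + s *: u) - h (p + s *: u)) - (h (p + s *: v) - h p) =
    ('D_u h (p + s *: v + x *: u) - 'D_u h (p + x *: u)) * s.
  pose k z := h (p + s *: v + z) - h (p + z).
  have [t ts|x xs] := @mvt_line k 0 u
    (fun x => 'D_u h (p + s *: v + x *: u) - 'D_u h (p + x *: u)) s s0.
    have shiftd c : U (c + t *: u) ->
        is_derive (0 + t *: u) u (fun z => h (c + z)) ('D_u h (c + t *: u)).
      move=> /dh dc.
      have E : (fun x : R => x^-1 *: (((fun z => h (c + z)) \o shift (0 + t *: u)) (x *: u) -
         h (c + (0 + t *: u)))) =
         (fun x : R => x^-1 *: ((h \o shift (c + t *: u)) (x *: u) - h (c + t *: u))).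
        by apply/funext => x /=; rewrite add0r; congr (_ *: (h _ - _)); rewrite addrCA.
      by split; rewrite /derivable /derive E.
    apply: is_deriveB; apply: shiftd; last exact: U0.
    by rewrite addrAC; apply: Us.
  by rewrite /k !addr0 add0r => e; exists x.
have [t ts|y ys ey] := @mvt_line ('D_u h) (p + x *: u) v
  (fun y => 'D_v ('D_u h) (p + x *: u + y *: v)) s s0.
  by apply: derivableP; apply: ddh; exact: Us.
exists x, y; split => //; rewrite -ey.
rewrite [p + x *: u + _]addrAC -ex [p + s *: v + _]addrAC; ring.
Qed.

(** Mean value arguments for [A] and [B] yield different intermediate points; continuity at [p]
    makes this harmless as the parallelogram shrinks. *)
Lemma continuous_eq_along (A B : V -> R) (U : set V) p u v : nbhs p U ->
  {for p, continuous A} -> {for p, continuous B} ->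
  (forall s, 0 < s ->
    (forall x y, 0 <= x <= s -> 0 <= y <= s -> U (p + x *: u + y *: v)) ->
    exists x y x' y', [/\ 0 <= x <= s, 0 <= y <= s, 0 <= x' <= s, 0 <= y' <= s &
      A (p + x *: u + y *: v) = B (p + x' *: u + y' *: v)]) ->
  A p = B p.
Proof.
move=> Up c1 c2 H; apply/eqP; rewrite -subr_eq0 -normr_le0.
apply/ler_addgt0Pr => e e0; rewrite add0r.
have e2 : 0 < e / 2 by lra.
move/cvgrPdist_lt/(_ _ e2) : c1 => n1; move/cvgrPdist_lt/(_ _ e2) : c2 => n2.
have [s s0 Ws] := nbhs_parallelogram u v (nbhsI Up (nbhsI n1 n2)).
have [x y hx hy|x [y [x' [y' [xs ys xs' ys' E]]]]] := H s s0; first by have [] := Ws x y hx hy.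
have [_ [B1 _]] := Ws x y xs ys; have [_ [_ B2]] := Ws x' y' xs' ys'.
rewrite /= E in B1; rewrite /= distrC in B2.
have := ler_normD (A p - B (p + x' *: u + y' *: v)) (B (p + x' *: u + y' *: v) - B p).
by rewrite addrA subrK => /le_trans; apply; lra.
Qed.

(** Schwarz's theorem: the second difference is symmetric in [u] and [v], and each order of
    expansion produces one of the two mixed derivatives. *)
Lemma derive_commute (U : set V) h p u v : nbhs p U ->
  (forall x, U x -> derivable h x u) -> (forall x, U x -> derivable h x v) ->
  (forall x, U x -> derivable ('D_u h) x v) -> (forall x, U x -> derivable ('D_v h) x u) ->
  {for p, continuous ('D_v ('D_u h))} -> {for p, continuous ('D_u ('D_v h))} ->
  'D_v ('D_u h) p = 'D_u ('D_v h) p.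
Proof.
move=> Up dhu dhv ddh ddh' c1 c2.
apply: (continuous_eq_along (u := u) (v := v) Up c1 c2) => s s0 Us.
have [x [y [xs ys E1]]] := second_difference (ltW s0) dhu ddh Us.
have Us' x0 y0 : 0 <= x0 <= s -> 0 <= y0 <= s -> U (p + x0 *: v + y0 *: u).
  by move=> h1 h2; rewrite addrAC; exact: Us.
have [y' [x' [ys' xs' E2]]] := second_difference (ltW s0) dhv ddh' Us'.
exists x, y, x', y'; apply: And5 xs ys xs' ys' _.
have cancel a b d : d = a * s * s -> d = b * s * s -> a = b.
  by have s0' : s != 0 by [rewrite gt_eqF]; move=> -> /(mulIf s0')/(mulIf s0').
apply: (cancel _ _ _ E1).
rewrite [p + x' *: u + _]addrAC; apply: etrans E2.
by rewrite [p + s *: v + _]addrAC; congr (_ + _); rewrite [LHS]addrAC.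
Qed.

End Lines.

(** * Germs, differentiation rules and coordinates *)

Section NearEq.
Variables (R : realType) (V W : normedModType R).

Lemma near_eq_differentiable (f g : V -> W) (x : V) :
  (\near x, f x = g x) -> differentiable f x -> differentiable g x.
Proof.
move=> fg df.
have gx : g x = f x by rewrite (nbhs_singleton fg).
have E : g \o shift x = cst (g x) + 'd f x +o_ 0 id.
  apply/eqaddoP => _/posnumP[e].
  have /eqaddoP/(_ e%:num)/(_ (gt0 e)) fe := diff_locally df.
  have fg0 : \forall y \near 0, f (y + x) = g (y + x).
    by move: fg; rewrite (near_shift 0) subr0.
  near=> y.
  rewrite !fctE /= gx.
  have -> : g (y + x) = f (y + x) by apply/esym; near: y.
  by near: y.
have dg := diff_unique (diff_continuous df) E.
by apply/diff_locallyP; rewrite dg; split=> //; exact: diff_continuous.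
Unshelve. all: by end_near. Qed.

End NearEq.

Section ScalarRules.
Variables (R : realType) (V : normedModType R).
Implicit Types (f g : V -> R) (p v : V).

Lemma is_derive_add f g p v a b : is_derive p v f a -> is_derive p v g b ->
  is_derive p v (fun q => f q + g q) (a + b).
Proof. exact: is_deriveD. Qed.

Lemma is_derive_sub f g p v a b : is_derive p v f a -> is_derive p v g b ->
  is_derive p v (fun q => f q - g q) (a - b).
Proof. exact: is_deriveB. Qed.

Lemma is_derive_mul f g p v a b : is_derive p v f a -> is_derive p v g b ->
  is_derive p v (fun q => f q * g q) (a * g p + f p * b).
Proof.
move=> fa gb; apply: is_derive_eq (is_deriveM fa gb) _.
by rewrite -![_ *: _]/(_ * _) addrC [g p * a]mulrC.
Qed.

Lemma derive_linear f p u v (a b : R) : differentiable f p ->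
  'D_(a *: u + b *: v) f p = a * 'D_u f p + b * 'D_v f p.
Proof. by move=> df; rewrite !deriveE // linearP linearZ. Qed.

Lemma differentiable_derivable f p v : differentiable f p -> is_derive p v f ('D_v f p).
Proof. by move=> df; apply: derivableP; exact: diff_derivable. Qed.

End ScalarRules.

Section ContinuousRules.
Variables (R : realType) (T : topologicalType).
Implicit Types (f g : T -> R) (p : T).

Lemma continuous_add f g p : {for p, continuous f} -> {for p, continuous g} ->
  {for p, continuous (fun q => f q + g q)}.
Proof. exact: continuousD. Qed.

Lemma continuous_sub f g p : {for p, continuous f} -> {for p, continuous g} ->
  {for p, continuous (fun q => f q - g q)}.
Proof. exact: continuousB. Qed.

Lemma continuous_mul f g p : {for p, continuous f} -> {for p, continuous g} ->
  {for p, continuous (fun q => f q * g q)}.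
Proof. exact: continuousM. Qed.

End ContinuousRules.

Section Coord.
Variables (R : realType) (V : normedModType R) (m : nat).
Implicit Types (F : V -> 'rV[R]_m) (p v : V).

Lemma differentiable_coord_comp F p k : differentiable F p ->
  differentiable (fun q => F q 0 k) p.
Proof.
move=> dF; apply: (@differentiable_comp _ _ _ _ F (fun M : 'rV[R]_m => M 0 k)) => //.
exact: differentiable_coord.
Qed.

Lemma derive_coord F p v k : differentiable F p ->
  'D_v (fun q => F q 0 k) p = 'D_v F p 0 k.
Proof. by move=> dF; rewrite derive_mx ?mxE //; exact: diff_derivable. Qed.

End Coord.

Definition C2_on (R : realType) (V : normedModType R) (U : set V) (h : V -> R) :=
  forall p, U p -> [/\ differentiable h p, forall v, differentiable ('D_v h) p &
    forall v w, {for p, continuous ('D_w ('D_v h))}].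

Lemma near_eq_continuous (T W : topologicalType) (f g : T -> W) (p : T) :
  (\near p, f p = g p) -> {for p, continuous f} -> {for p, continuous g}.
Proof.
move=> fg cf; rewrite /prop_for /continuous_at -(nbhs_singleton fg).
by apply: cvg_trans cf; apply: near_eq_cvg.
Qed.

Lemma smooth_coord_C2 (R : realType) (V : normedModType R) (m : nat) (U : set V)
    (F : V -> 'rV[R]_m) k :
  open U -> smooth_on U F -> C2_on U (fun q => F q 0 k).
Proof.
move=> oU sF.
have [dF dF'] := sF 2%N.
have d1 p v : U p -> \near p, 'D_v F p 0 k = 'D_v (fun q => F q 0 k) p.
  move=> Up; apply: (nbhsS _ (open_nbhs_nbhs (conj oU Up))) => q Uq.
  by rewrite derive_coord //; exact: dF.
have d2 p v w : U p -> 'D_w ('D_v F) p 0 k = 'D_w ('D_v (fun q => F q 0 k)) p.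
  move=> Up; rewrite -(near_eq_derive w (d1 p v Up)) derive_coord //.
  by have [] := dF' v; auto.
move=> p Up; split; first exact/differentiable_coord_comp/dF.
- move=> v; apply: near_eq_differentiable (d1 p v Up) _.
  by apply: differentiable_coord_comp; have [] := dF' v; auto.
- move=> v w; apply: (@near_eq_continuous _ _ (fun q => 'D_w ('D_v F) q 0 k)).
    by apply: (nbhsS _ (open_nbhs_nbhs (conj oU Up))) => q; exact: d2.
  apply: (@continuous_comp _ _ _ ('D_w ('D_v F)) (fun M : 'rV[R]_m => M 0 k)).
    by have [_ /(_ w)] := dF' v; apply.
  exact: coord_continuous.
Qed.

(** * The left-invariant frame *)

Section Frame.
Variable R : realType.
Local Notation V := 'rV[R]_3.
Implicit Types (h f g : V -> R) (p q u v : V) (U : set V).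

Definition dX : V := vec3 1 0 0.
Definition dY : V := vec3 0 1 0.
Definition dZ : V := vec3 0 0 1.

(* Derivative along the left-invariant frame [X, Y, Z]; every index above 2 also means [Z]. *)
Definition fr (i : nat) h p : R :=
  match i with
  | 0%N => 'D_dX h p
  | 1%N => 'D_dY h p + p 0 0 * 'D_dZ h p
  | _ => 'D_dZ h p
  end.

Definition frame (i : nat) p : V :=
  match i with
  | 0%N => dX
  | 1%N => vec3 0 1 (p 0 0)
  | _ => dZ
  end.

Lemma frameE1 p : frame 1 p = 1 *: dY + p 0 0 *: dZ.
Proof. by apply: vec3_eq; rewrite !mxE /=; ring. Qed.

Lemma frE i h p : differentiable h p -> fr i h p = 'D_(frame i p) h p.
Proof.
by case: i => [|[|i]] dh //=; rewrite -/(frame 1 p) frameE1 derive_linear // mul1r.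
Qed.

Lemma is_fr i h p : differentiable h p -> is_derive p (frame i p) h (fr i h p).
Proof. by move=> dh; rewrite frE //; exact: differentiable_derivable. Qed.

Lemma fr_eq i h p d : differentiable h p -> is_derive p (frame i p) h d -> fr i h p = d.
Proof. by move=> dh [_ <-]; rewrite frE. Qed.

Lemma frM i f g p : differentiable f p -> differentiable g p ->
  fr i (fun q => f q * g q) p = fr i f p * g p + f p * fr i g p.
Proof.
move=> df dg; apply: fr_eq; first exact: differentiableM.
by apply: is_derive_mul; exact: is_fr.
Qed.

Lemma frD i f g p : differentiable f p -> differentiable g p ->
  fr i (fun q => f q + g q) p = fr i f p + fr i g p.
Proof.
move=> df dg; apply: fr_eq; first exact: differentiableD.
by apply: is_derive_add; exact: is_fr.
Qed.

Lemma frB i f g p : differentiable f p -> differentiable g p ->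
  fr i (fun q => f q - g q) p = fr i f p - fr i g p.
Proof.
move=> df dg; apply: fr_eq; first exact: differentiableB.
by apply: is_derive_sub; exact: is_fr.
Qed.

Lemma fr_near i f g p : (\near p, f p = g p) -> fr i f p = fr i g p.
Proof.
by move=> fg; case: i => [|[|i]] /=; rewrite ?(near_eq_derive _ fg).
Qed.

Lemma differentiable_x p : differentiable (fun q : V => q 0 0) p.
Proof. exact: differentiable_coord. Qed.

Lemma derive_x p v : 'D_v (fun q : V => q 0 0) p = v 0 0.
Proof. by rewrite (@derive_coord _ _ _ id) ?derive_id. Qed.

Lemma C2_fr U h i p : C2_on U h -> U p -> differentiable (fr i h) p.
Proof.
move=> ch Up; have [dh ddh _] := ch p Up.
case: i => [|[|i]]; [exact: ddh| |exact: ddh].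
apply: (@differentiableD _ _ _ ('D_dY h) (fun q => q 0 0 * 'D_dZ h q)) => //.
by apply: (@differentiableM _ _ (fun q : V => q 0 0) ('D_dZ h)) => //; exact: differentiable_x.
Qed.

Lemma derive_fr1 U h p v : C2_on U h -> U p ->
  'D_v (fr 1 h) p = 'D_v ('D_dY h) p + v 0 0 * 'D_dZ h p + p 0 0 * 'D_v ('D_dZ h) p.
Proof.
move=> ch Up; have [dh ddh _] := ch p Up.
have H : is_derive p v (fr 1 h) ('D_v ('D_dY h) p +
    ('D_v (fun q : V => q 0 0) p * 'D_dZ h p + p 0 0 * 'D_v ('D_dZ h) p)).
  apply: (@is_derive_add _ _ ('D_dY h) (fun q => q 0 0 * 'D_dZ h q)).
    exact: differentiable_derivable.
  apply: (@is_derive_mul _ _ (fun q : V => q 0 0) ('D_dZ h)).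
    by apply: differentiable_derivable; exact: differentiable_x.
  exact: differentiable_derivable.
by have [_ ->] := H; rewrite derive_x addrA.
Qed.

Lemma C2_commute U h p u v : open U -> C2_on U h -> U p ->
  'D_v ('D_u h) p = 'D_u ('D_v h) p.
Proof.
move=> oU ch Up; have [_ _ ch2] := ch p Up.
apply: (@derive_commute _ _ U) => //.
- exact: open_nbhs_nbhs.
- by move=> q /ch[dh _ _]; exact: diff_derivable.
- by move=> q /ch[dh _ _]; exact: diff_derivable.
- by move=> q /ch[_ dh _]; exact: diff_derivable.
- by move=> q /ch[_ dh _]; exact: diff_derivable.
Qed.

Lemma C2_fr_continuous U h i j p : open U -> C2_on U h -> U p ->
  {for p, continuous (fr j (fr i h))}.
Proof.
move=> oU ch Up; have [dh ddh ch2] := ch p Up.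
have cx : {for p, continuous (fun q : V => q 0 0)} by exact: coord_continuous.
have cdh v : {for p, continuous ('D_v h)} by apply: differentiable_continuous.
have cv v : {for p, continuous ('D_v (fr i h))}.
  case: i => [|[|i]]; [exact: ch2| |exact: ch2].
  apply: (@near_eq_continuous _ _ (fun p => 'D_v ('D_dY h) p + v 0 0 * 'D_dZ h p +
     p 0 0 * 'D_v ('D_dZ h) p)).
    apply: (nbhsS _ (open_nbhs_nbhs (conj oU Up))) => q Uq.
    by rewrite (derive_fr1 _ ch Uq).
  apply: continuous_add; first apply: continuous_add; first exact: ch2.
    by apply: continuous_mul; [exact: cst_continuous|exact: cdh].
  by apply: continuous_mul; [exact: cx|exact: ch2].
case: j => [|[|j]]; [exact: cv| |exact: cv].
by apply: continuous_add; [exact: cv|apply: continuous_mul; [exact: cx|exact: cv]].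
Qed.

Lemma fr_bracket01 U h p : open U -> C2_on U h -> U p ->
  fr 0 (fr 1 h) p - fr 1 (fr 0 h) p = fr 2 h p.
Proof.
move=> oU ch Up; rewrite [fr 0 _ p]/= (derive_fr1 _ ch Up) /=.
rewrite vec3E0.
have alg (a a' b b' c x : R) : a = a' -> b = b' ->
  a + 1 * c + x * b - (a' + x * b') = c by move=> -> ->; ring.
exact: alg (C2_commute dY dX oU ch Up) (C2_commute dZ dX oU ch Up).
Qed.

Lemma fr_bracket02 U h p : open U -> C2_on U h -> U p ->
  fr 0 (fr 2 h) p = fr 2 (fr 0 h) p.
Proof. by move=> oU ch Up; exact: C2_commute oU ch Up. Qed.

Lemma fr_bracket12 U h p : open U -> C2_on U h -> U p ->
  fr 1 (fr 2 h) p = fr 2 (fr 1 h) p.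
Proof.
move=> oU ch Up; rewrite [fr 2 (fr 1 h) p]/= (derive_fr1 _ ch Up) /=.
rewrite vec3E0.
have alg (a a' b c x : R) : a = a' -> a' + x * b = a + 0 * c + x * b.
  by move=> ->; ring.
exact: alg (C2_commute dY dZ oU ch Up).
Qed.

End Frame.

(** * Orthogonal matrices and Koszul's formula *)

Lemma lt3_cases (n : nat) : (n < 3)%N -> [\/ n = 0%N, n = 1%N | n = 2%N].
Proof.
by case: n => [|[|[|//]]] _; [apply: Or31|apply: Or32|apply: Or33].
Qed.

Section Algebra.
Variable R : realType.
Implicit Types (a : nat -> nat -> R).

Definition dot3 (f g : nat -> R) : R := f 0%N * g 0%N + f 1%N * g 1%N + f 2%N * g 2%N.

Definition det3 a : R :=
  a 0%N 0%N * (a 1%N 1%N * a 2%N 2%N - a 1%N 2%N * a 2%N 1%N)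
  - a 0%N 1%N * (a 1%N 0%N * a 2%N 2%N - a 1%N 2%N * a 2%N 0%N)
  + a 0%N 2%N * (a 1%N 0%N * a 2%N 1%N - a 1%N 1%N * a 2%N 0%N).

Lemma sum3 (f : 'I_3 -> R) : \sum_i f i = f 0 + f 1 + f 2.
Proof.
rewrite !big_ord_recl big_ord0 addr0 !addrA; congr (_ + f _ + f _); exact: val_inj.
Qed.

Lemma orthonormal_rows a :
  (forall k l, (k < 3)%N -> (l < 3)%N ->
    dot3 (a^~ k) (a^~ l) = (k == l)%:R) ->
  forall m n, (m < 3)%N -> (n < 3)%N -> dot3 (a m) (a n) = (m == n)%:R.
Proof.
move=> oc m n m3 n3.
pose A : 'M[R]_3 := \matrix_(i, j) a i j.
have : A^T *m A = 1%:M.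
  apply/matrixP => i j; rewrite !mxE sum3 !mxE.
  by have := oc i j (ltn_ord i) (ltn_ord j); rewrite /dot3 => ->.
move/mulmx1C/matrixP/(_ (Ordinal m3) (Ordinal n3)).
by rewrite !mxE sum3 !mxE.
Qed.

(** The third row [z] is the cross product [w] of the first two, [x] and [y]: by Lagrange's identity
    [|z - w|^2 = |z|^2 - 2 det + |x|^2 |y|^2 - (x . y)^2], which is [1 - 2 + 1 - 0]. *)
Lemma third_row a :
  (forall m n, (m < 3)%N -> (n < 3)%N -> dot3 (a m) (a n) = (m == n)%:R) ->
  det3 a = 1 ->
  [/\ a 2%N 0%N = a 0%N 1%N * a 1%N 2%N - a 0%N 2%N * a 1%N 1%N,
      a 2%N 1%N = a 0%N 2%N * a 1%N 0%N - a 0%N 0%N * a 1%N 2%N &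
      a 2%N 2%N = a 0%N 0%N * a 1%N 1%N - a 0%N 1%N * a 1%N 0%N].
Proof.
move=> o d.
have := o 0 0 isT isT; have := o 0 1 isT isT; have := o 1 1 isT isT; have := o 2 2 isT isT.
move: d; rewrite /dot3 /det3 /=.
move: (a 0%N 0%N) (a 0%N 1%N) (a 0%N 2%N) (a 1%N 0%N) (a 1%N 1%N) (a 1%N 2%N)
  (a 2%N 0%N) (a 2%N 1%N) (a 2%N 2%N) => x0 x1 x2 y0 y1 y2 z0 z1 z2 d zz yy xy xx.
pose w0 := x1 * y2 - x2 * y1; pose w1 := x2 * y0 - x0 * y2; pose w2 := x0 * y1 - x1 * y0.
have e : (z0 - w0) ^+ 2 + (z1 - w1) ^+ 2 + (z2 - w2) ^+ 2 = 0.
  have -> : (z0 - w0) ^+ 2 + (z1 - w1) ^+ 2 + (z2 - w2) ^+ 2 =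
    (z0 * z0 + z1 * z1 + z2 * z2) - 2 *
     (x0 * (y1 * z2 - y2 * z1) - x1 * (y0 * z2 - y2 * z0) + x2 * (y0 * z1 - y1 * z0)) +
    (x0 * x0 + x1 * x1 + x2 * x2) * (y0 * y0 + y1 * y1 + y2 * y2)
    - (x0 * y0 + x1 * y1 + x2 * y2) ^+ 2 by rewrite /w0 /w1 /w2; ring.
  by rewrite zz d xx yy xy; ring.
have h0 := sqr_ge0 (z0 - w0); have h1 := sqr_ge0 (z1 - w1); have h2 := sqr_ge0 (z2 - w2).
have sq0 x : x ^+ 2 = 0 :> R -> x = 0 by move=> /eqP; rewrite sqrf_eq0 => /eqP.
move: e h0 h1 h2 (@sq0 (z0 - w0)) (@sq0 (z1 - w1)) (@sq0 (z2 - w2)).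
move: (_ ^+ 2) (_ ^+ 2) (_ ^+ 2) => s0 s1 s2 e h0 h1 h2 q0 q1 q2.
by split; apply/subr0_eq; [apply: q0|apply: q1|apply: q2]; lra.
Qed.

(** The last column has no length left for [b02] and [b12]; the remaining block is orthogonal of
    determinant [s], so its second column is [s] times the quarter turn of its first. *)
Lemma rotation_entries (b00 b01 b02 b10 b11 b12 s : R) :
  s = b00 * b11 - b01 * b10 -> s * s = 1 ->
  b00 * b00 + b10 * b10 = 1 -> b00 * b01 + b10 * b11 = 0 ->
  b02 * b02 + b12 * b12 + s * s = 1 ->
  [/\ b02 = 0, b12 = 0, b01 = - (s * b10) & b11 = s * b00].
Proof.
move=> m2 s2 c00 c01 c22.
have e : b02 * b02 + b12 * b12 = 0 by lra.
have h0 := sqr_ge0 b02; have h1 := sqr_ge0 b12; rewrite !expr2 in h0 h1.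
have sq0 x : x * x = 0 :> R -> x = 0 by move/eqP; rewrite mulf_eq0 orbb => /eqP.
split; first by apply: sq0; lra.
- by apply: sq0; lra.
- have -> : s * b10 = b10 * b11 * b00 - b01 * (b10 * b10) by rewrite m2; ring.
  have -> : b10 * b10 = 1 - b00 * b00 by lra.
  have -> : b10 * b11 = - (b00 * b01) by lra.
  ring.
- have -> : s * b00 = b00 * b00 * b11 - b00 * b01 * b10 by rewrite m2; ring.
  have -> : b00 * b01 = - (b10 * b11) by lra.
  have -> : b00 * b00 = 1 - b10 * b10 by lra.
  ring.
Qed.

Section Koszul.
Variables (a : nat -> nat -> R) (d : nat -> nat -> nat -> R).
Hypothesis cols : forall k l, (k < 3)%N -> (l < 3)%N ->
  dot3 (a^~ k) (a^~ l) = (k == l)%:R.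
Hypothesis det1 : det3 a = 1.
Hypothesis skew : forall j k l, (j < 3)%N -> (k < 3)%N -> (l < 3)%N ->
  dot3 (d j ^~ k) (a^~ l) + dot3 (a^~ k) (d j ^~ l) = 0.

Let c (j k : nat) : R := ((j == 0) && (k == 1%N))%:R - ((j == 1%N) && (k == 0))%:R.

(** Structure equations of the pulled-back coframe: the first term comes from [[X, Y] = Z] on the
    source, the second from [d (dz - x dy) = - dx /\ dy] on the target. *)
Hypothesis curl : forall j n k, (j < 3)%N -> (n < 3)%N -> (k < 3)%N ->
  d j n k - d k n j =
  c j k * a n 2%N - (n == 2%N)%:R * (a 0%N j * a 1%N k - a 0%N k * a 1%N j).

Let rows := orthonormal_rows cols.
Let D j k l := dot3 (d j ^~ k) (a^~ l).
Let T j k l := c j k * (2%N == l)%:R - a 2%N l * (a 0%N j * a 1%N k - a 0%N k * a 1%N j).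

Let torsion j k l : (j < 3)%N -> (k < 3)%N -> (l < 3)%N -> D j k l - D k j l = T j k l.
Proof.
move=> j3 k3 l3; rewrite /T -(cols (isT : (2 < 3)%N) l3).
have := curl j3 (isT : (0 < 3)%N) k3; have := curl j3 (isT : (1 < 3)%N) k3.
have := curl j3 (isT : (2 < 3)%N) k3; rewrite /= /D /dot3 => e2 e1 e0.
transitivity ((d j 0%N k - d k 0%N j) * a 0%N l + (d j 1%N k - d k 1%N j) * a 1%N l +
  (d j 2%N k - d k 2%N j) * a 2%N l); first by ring.
by rewrite e0 e1 e2; ring.
Qed.

(** [D] is skew in its last two indices, so in the signed sum of the three cyclic torsions all terms
    cancel except [D j k l - D j l k], which is [2 * D j k l]. *)
Let koszul j k l : (j < 3)%N -> (k < 3)%N -> (l < 3)%N ->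
  D j k l = (T j k l - T k l j + T l j k) / 2.
Proof.
move=> j3 k3 l3; rewrite -!torsion //.
have sk x y z : (x < 3)%N -> (y < 3)%N -> (z < 3)%N -> D x y z = - D x z y.
  move=> x3 y3 z3; apply/eqP; rewrite -subr_eq0 opprK; apply/eqP.
  rewrite -(skew x3 y3 z3); congr (_ + _); rewrite /D /dot3; ring.
rewrite (sk k l j) // (sk l k j) // (sk j l k) //; lra.
Qed.

Let expand j n k : (j < 3)%N -> (n < 3)%N -> (k < 3)%N ->
  d j n k = a n 0%N * D j k 0%N + a n 1%N * D j k 1%N + a n 2%N * D j k 2%N.
Proof.
move=> j3 n3 k3.
transitivity (d j 0%N k * dot3 (a n) (a 0%N) + d j 1%N k * dot3 (a n) (a 1%N)
   + d j 2%N k * dot3 (a n) (a 2%N)); last by rewrite /D /dot3; ring.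
rewrite !rows //; case: n n3 => [|[|[|//]]] _ /=; ring.
Qed.

Let mu (j k : nat) : R :=
  match j, k with
  | 0%N, 1%N => a 2%N 2%N | 1%N, 0%N => - a 2%N 2%N
  | 0%N, 2%N => - a 2%N 1%N | 2%N, 0%N => a 2%N 1%N
  | 1%N, 2%N => a 2%N 0%N | 2%N, 1%N => - a 2%N 0%N
  | _, _ => 0
  end.

Let minor j k : (j < 3)%N -> (k < 3)%N ->
  a 0%N j * a 1%N k - a 0%N k * a 1%N j = mu j k.
Proof.
have [m0 m1 m2] := third_row rows det1.
by case: j k => [|[|[|//]]] [|[|[|//]]] _ _; rewrite /mu ?m0 ?m1 ?m2; ring.
Qed.

Let s (j : nat) (m : nat) : R := a 2%N j * a 2%N m - ((j == 2%N) && (m == 2%N))%:R.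

(* Row [j] of [s] is the rotation vector of the connection along the [j]-th frame field. *)
Let connection j k l : (j < 3)%N -> (k < 3)%N -> (l < 3)%N ->
  D j k l =
  match k, l with
  | 0%N, 1%N => s j 2 | 1%N, 0%N => - s j 2
  | 0%N, 2%N => - s j 1 | 2%N, 0%N => s j 1
  | 1%N, 2%N => s j 0 | 2%N, 1%N => - s j 0
  | _, _ => 0
  end.
Proof.
have n1 := rows (isT : (2 < 3)%N) (isT : (2 < 3)%N); move: n1; rewrite /dot3 /= => n1 j3 k3 l3.
rewrite koszul // /T !minor // /mu /c /s.
by case: j k l j3 k3 l3 => [|[|[|//]]] [|[|[|//]]] [|[|[|//]]] _ _ _ /=; lra.
Qed.

(** By [connection], the derivative of a row [r] along the [j]-th field is the cross product of [r]
    with row [j] of [s], that is with [n_j n - [j = 2] e_2] where [n] is the third row. For [r = n]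
    the first summand contributes nothing. *)
Lemma third_row_derivative j : (j < 3)%N ->
  [/\ d j 2%N 0%N = - (j == 2%N)%:R * a 2%N 1%N,
      d j 2%N 1%N = (j == 2%N)%:R * a 2%N 0%N & d j 2%N 2%N = 0].
Proof.
move=> j3; rewrite !expand // !connection // /s.
by case: j j3 => [|[|[|//]]] _ /=; split; ring.
Qed.

(** If the third row is [e_2] or [- e_2], the two summands of every rotation vector cancel and the
    whole connection vanishes. *)
Lemma derivative_vertical_frame j n k : (j < 3)%N -> (n < 3)%N -> (k < 3)%N ->
  a 2%N 0%N = 0 -> a 2%N 1%N = 0 -> d j n k = 0.
Proof.
move=> j3 n3 k3 z0 z1; rewrite expand // !connection // /s.
have := rows (isT : (2 < 3)%N) (isT : (2 < 3)%N); rewrite /dot3 /= z0 z1 !mul0r !add0r => z2.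
by case: j j3 => [|[|[|//]]] _; case: k k3 => [|[|[|//]]] _; rewrite /= ?z0 ?z1 ?z2; ring.
Qed.

End Koszul.
End Algebra.

(** * The differential of a map in the moving frames *)

Section FrameMatrix.
Variable R : realType.
Local Notation V := 'rV[R]_3.
Implicit Types (h : V -> R) (F : V -> V) (p q u v : V) (U : set V).

(* Matrix of ['d F p] in the frames at [p] and [F p]; row 2 is the pullback of [dz - x dy]. *)
Definition fmat F (n i : nat) p : R :=
  match n with
  | 0%N => fr i (fun q => F q 0 0) p
  | 1%N => fr i (fun q => F q 0 1) p
  | _ => fr i (fun q => F q 0 2) p - F p 0 0 * fr i (fun q => F q 0 1) p
  end.

Definition fmatp F p (n i : nat) := fmat F n i p.

Definition bracket (j k : nat) : R :=
  ((j == 0) && (k == 1%N))%:R - ((j == 1%N) && (k == 0))%:R.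

Lemma fr_bracket U h j k p : open U -> C2_on U h -> U p -> (j < 3)%N -> (k < 3)%N ->
  fr j (fr k h) p - fr k (fr j h) p = bracket j k * fr 2 h p.
Proof.
move=> oU ch Up; have e01 := fr_bracket01 oU ch Up.
have e02 := fr_bracket02 oU ch Up; have e12 := fr_bracket12 oU ch Up.
have alg (a b c : R) : a - b = c -> b - a = (0 - 1) * c by move=> <-; ring.
have alg1 (a b c : R) : a - b = c -> a - b = (1 - 0) * c by move=> ->; ring.
have alg2 (a b c : R) : a = b -> a - b = (0 - 0) * c by move=> ->; ring.
case: j k => [|[|[|//]]] [|[|[|//]]] _ _; rewrite /bracket.
- exact (alg2 _ _ _ erefl).
- exact (alg1 _ _ _ e01).
- exact (alg2 _ _ _ e02).
- exact (alg _ _ _ e01).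
- exact (alg2 _ _ _ erefl).
- exact (alg2 _ _ _ e12).
- exact (alg2 _ _ _ (esym e02)).
- exact (alg2 _ _ _ (esym e12)).
- exact (alg2 _ _ _ erefl).
Qed.

Section Coordinates.
Variables (U : set V) (F : V -> V).
Hypotheses (oU : open U) (cF : forall k, C2_on U (fun q => F q 0 k)).

Let dF p k : U p -> differentiable (fun q => F q 0 k) p.
Proof. by move=> Up; have [] := cF k Up. Qed.

Let dfrF p k i : U p -> differentiable (fr i (fun q => F q 0 k)) p.
Proof. by move=> Up; exact: C2_fr (cF k) Up. Qed.

Lemma differentiable_fmat n i p : U p -> differentiable (fmat F n i) p.
Proof.
move=> Up; case: n => [|[|n]]; [exact: dfrF|exact: dfrF|].
apply: (@differentiableB _ _ _ _ (fun q => F q 0 0 * fr i (fun q => F q 0 1) q)).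
  exact: dfrF.
apply: (@differentiableM _ _ (fun q => F q 0 0)); [exact: dF|exact: dfrF].
Qed.

Lemma fr_fmat2 j k n p : U p -> fr j (fmat F n.+2 k) p =
  fr j (fr k (fun q => F q 0 2)) p - (fr j (fun q => F q 0 0) p * fr k (fun q => F q 0 1) p
   + F p 0 0 * fr j (fr k (fun q => F q 0 1)) p).
Proof.
move=> Up.
have := @frB R j (fr k (fun q => F q 0 2)) (fun q => F q 0 0 * fr k (fun q => F q 0 1) q) p.
have := @frM R j (fun q => F q 0 0) (fr k (fun q => F q 0 1)) p.
move=> m b; apply: etrans (b _ _) _; first exact: dfrF.
  apply: (@differentiableM _ _ (fun q => F q 0 0)); [exact: dF|exact: dfrF].
by rewrite m //; [exact: dF|exact: dfrF].
Qed.

(** Rows 0 and 1 are the closed forms [dx] and [dy] pulled back, so only the bracket of the frame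
    remains; for row 2 the product rule on [x dy] adds the pullback of [- dx /\ dy]. *)
Lemma fmat_curl j n k p : U p -> (j < 3)%N -> (n < 3)%N -> (k < 3)%N ->
  fr j (fmat F n k) p - fr k (fmat F n j) p = bracket j k * fmat F n 2 p
   - (n == 2%N)%:R * (fmat F 0 j p * fmat F 1 k p - fmat F 0 k p * fmat F 1 j p).
Proof.
move=> Up j3 n3 k3.
have br m := fr_bracket oU (cF m) Up j3 k3.
case: n n3 => [|[|[|//]]] _ /=.
- by rewrite mul0r subr0; exact: br.
- by rewrite mul0r subr0; exact: br.
- rewrite !fr_fmat2 //.
  have alg (a a' b b' u v u' v' w z x c : R) : a - a' = c * w -> b - b' = c * z ->
      a - (u * v + x * b) - (a' - (u' * v' + x * b')) =
      c * (w - x * z) - 1 * (u * v - u' * v').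
    move=> E1 E2; transitivity ((a - a') - x * (b - b') - (u * v - u' * v')); first by ring.
    by rewrite E1 E2; ring.
  exact: alg (br _) (br _).
Qed.

Lemma fmat_fr_continuous j n k p : U p -> {for p, continuous (fr j (fmat F n k))}.
Proof.
move=> Up; case: n => [|[|n]].
- exact: C2_fr_continuous oU (cF _) Up.
- exact: C2_fr_continuous oU (cF _) Up.
- apply: near_eq_continuous.
    apply: (nbhsS _ (open_nbhs_nbhs (conj oU Up))) => q Uq; apply/esym.
    exact: (fr_fmat2 j k n Uq).
  have cd (h : V -> R) : differentiable h p -> {for p, continuous h}.
    exact: differentiable_continuous.
  apply: continuous_sub; first exact: C2_fr_continuous oU (cF _) Up.
  apply: continuous_add; apply: continuous_mul.
  + by apply: cd; exact: dfrF.
  + by apply: cd; exact: dfrF.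
  + by apply: cd; exact: dF.
  + exact: C2_fr_continuous oU (cF _) Up.
Qed.

End Coordinates.

Lemma fr_coord F p i k : differentiable F p ->
  fr i (fun q => F q 0 k) p = 'd F p (frame i p) 0 k.
Proof.
move=> dF; rewrite frE; last exact: differentiable_coord_comp.
by rewrite derive_coord // deriveE.
Qed.

Lemma det_mx3 (A : 'M[R]_3) : \det A =
  A 0 0 * (A 1 1 * A 2 2 - A 1 2 * A 2 1) - A 0 1 * (A 1 0 * A 2 2 - A 1 2 * A 2 0)
  + A 0 2 * (A 1 0 * A 2 1 - A 1 1 * A 2 0).
Proof.
pose f i j := A (inord i) (inord j).
have E i j : A i j = f (nat_of_ord i) (nat_of_ord j) by rewrite /f !inord_val.
rewrite !(expand_det_row _ ord0) !big_ord_recl !big_ord0 /cofactor.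
rewrite !(expand_det_row _ ord0) !big_ord_recl !big_ord0 /cofactor !det_mx11 !mxE.
by rewrite !E /= /bump /=; ring.
Qed.

Lemma det3E (a : nat -> nat -> R) : det3 a = \det (\matrix_(i < 3, j < 3) a i j).
Proof. by rewrite det_mx3 !mxE. Qed.

(** Both moving frames are unitriangular over the coordinate basis, so changing to them leaves the
    Jacobian determinant unchanged. *)
Lemma det_fmat F p : differentiable F p -> det3 (fmatp F p) = \det ('J F p).
Proof.
move=> dF; rewrite det_mx3.
have e k : [/\ 'J F p 0 k = 'd F p (dX R) 0 k, 'J F p 1 k = 'd F p (dY R) 0 k &
    'J F p 2 k = 'd F p (dZ R) 0 k].
  have d (v : V) (i : 'I_3) : v = delta_mx 0 i -> 'J F p i k = 'd F p v 0 k.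
    by move=> ->; rewrite /jacobian mxE.
  by split; apply: d; apply: vec3_eq; rewrite !mxE.
have f1 : 'd F p (frame 1 p) = 'd F p (dY R) + p 0 0 *: 'd F p (dZ R).
  by rewrite frameE1 scale1r linearD linearZ.
have e0 k : 'J F p 0 k = 'd F p (dX R) 0 k by have [] := e k.
have e1 k : 'J F p 1 k = 'd F p (dY R) 0 k by have [] := e k.
have e2 k : 'J F p 2 k = 'd F p (dZ R) 0 k by have [] := e k.
rewrite /det3 /fmatp /fmat !fr_coord // f1 [frame 0 p]/= [frame 2 p]/= !e0 !e1 !e2.
move: ('d F p (dX R)) ('d F p (dY R)) ('d F p (dZ R)) => u v w.
rewrite !mxE; ring.
Qed.

(** * Growth of functions along the frame fields *)

Lemma derivative_bound_line h p v (C s : R) : 0 <= s ->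
  (forall t, 0 <= t <= s -> differentiable h (p + t *: v) /\
     `|'D_v h (p + t *: v)| <= C) ->
  `|h (p + s *: v) - h p| <= C * s.
Proof.
move=> s0 H.
have [|c cs ->] := @mvt_line _ _ h p v (fun t => 'D_v h (p + t *: v)) s s0.
  by move=> t /H[dh _]; exact: differentiable_derivable.
by rewrite normrM [`|s|]ger0_norm // ler_wpM2r //; have [] := H c cs.
Qed.

(* Length [s] sides along [X, Y, -X, -Y] close up to a vertical displacement [s ^+ 2]. *)
Lemma commutator_path_bound h (D : set V) (x y z C s : R) : 0 <= s ->
  (forall q, D q -> [/\ differentiable h q, `|fr 0 h q| <= C & `|fr 1 h q| <= C]) ->
  (forall t, 0 <= t <= s ->
    [/\ D (vec3 (x + t) y z), D (vec3 (x + s) (y + t) (z + (x + s) * t)),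
        D (vec3 (x + t) (y + s) (z + (x + s) * s)) &
        D (vec3 x (y + t) (z + s * s + x * t))]) ->
  `|h (vec3 x y (z + s * s)) - h (vec3 x y z)| <= 4 * C * s.
Proof.
move=> s0 H path.
have side0 a b c : (forall t, 0 <= t <= s -> D (vec3 (a + t) b c)) ->
    `|h (vec3 (a + s) b c) - h (vec3 a b c)| <= C * s.
  have e t : vec3 (a + t) b c = vec3 a b c + t *: dX R.
    by apply: vec3_eq; rewrite !mxE /=; ring.
  move=> Ds; rewrite e; apply: derivative_bound_line => // t ts; rewrite -e.
  by have [] := H _ (Ds t ts).
have side1 a b c : (forall t, 0 <= t <= s -> D (vec3 a (b + t) (c + a * t))) ->
    `|h (vec3 a (b + s) (c + a * s)) - h (vec3 a b c)| <= C * s.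
  have e t : vec3 a (b + t) (c + a * t) = vec3 a b c + t *: vec3 0 1 a.
    by apply: vec3_eq; rewrite !mxE /=; ring.
  move=> Ds; rewrite e; apply: derivative_bound_line => // t ts; rewrite -e.
  have [dh _] := H _ (Ds t ts); rewrite (frE 1 dh) /frame vec3E0 => b1; exact: conj dh b1.
have b1 := side0 x y z (fun t ts => let: And4 a _ _ _ := path t ts in a).
have b2 := side1 (x + s) y z (fun t ts => let: And4 _ a _ _ := path t ts in a).
have b3 := side0 x (y + s) (z + (x + s) * s) (fun t ts => let: And4 _ _ a _ := path t ts in a).
have b4 := side1 x y (z + s * s) (fun t ts => let: And4 _ _ _ a := path t ts in a).
(* The third and fourth sides are traversed backwards; they share the corner whose height has these
   two expressions. *)
have e : z + s * s + x * s = z + (x + s) * s by ring.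
rewrite e in b4; move: b1 b2 b3 b4; rewrite !ler_norml.
move=> /andP[? ?] /andP[? ?] /andP[? ?] /andP[? ?]; apply/andP; split; lra.
Qed.

End FrameMatrix.

(** * Rigidity of isometries *)

Section Isometry.
Variable R : realType.
Local Notation V := 'rV[R]_3.
Implicit Types (h : V -> R) (F : V -> V) (p q u v : V) (U : set V).

Lemma nil_metric_frame_dot F p k l : differentiable F p ->
  nil_metric (F p) ('d F p (frame k p)) ('d F p (frame l p)) =
  dot3 ((fmatp F p)^~ k) ((fmatp F p)^~ l).
Proof.
by move=> dF; rewrite /dot3 /fmatp /fmat !fr_coord.
Qed.

Lemma nil_metric_orthonormal p k l : (k < 3)%N -> (l < 3)%N ->
  nil_metric p (frame k p) (frame l p) = (k == l)%:R.
Proof.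
by case: k l => [|[|[|//]]] [|[|[|//]]] _ _; rewrite /nil_metric /frame !vec3E /=; ring.
Qed.

(** An integrated form of [[X, Y] = Z] that asks only for first derivatives of [h]: with [C = 0],
    commutator paths show that [h] is constant on vertical lines. *)
Lemma vertical_derivative_eq0 h : (forall q, differentiable h q) ->
  (forall q, fr 0 h q = 0) -> (forall q, fr 1 h q = 0) -> forall q, fr 2 h q = 0.
Proof.
move=> dh h0 h1 q.
have up p t : 0 <= t -> h (p + t *: dZ R) = h p.
  move=> t0.
  have [s s0 st] : exists2 s, 0 <= s & s * s = t.
    by exists (Num.sqrt t); rewrite ?sqrtr_ge0 // -expr2 sqr_sqrtr.
  have := @commutator_path_bound R h setT (p 0 0) (p 0 1) (p 0 2) 0 s s0.
  rewrite mulr0 mul0r normr_le0 subr_eq0 => /(_ _ _)/eqP H.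
  have -> : p + t *: dZ R = vec3 (p 0 0) (p 0 1) (p 0 2 + s * s).
    by rewrite st; apply: vec3_eq; rewrite !mxE /=; ring.
  rewrite H //; last by move=> x _ ; rewrite h0 h1 normr0.
  by congr h; apply: vec3_eq; rewrite !mxE.
have const t : h (q + t *: dZ R) = h q.
  have [t0|t0] := leP 0 t; first exact: up.
  rewrite -(up (q + t *: dZ R) (- t)) ?oppr_ge0 ?ltW //.
  by rewrite scaleNr addrK.
rewrite (frE 2 (dh q)) /=; have : is_derive (q + 0 *: dZ R) (dZ R) h ('D_(dZ R) h q).
  by rewrite scale0r addr0; exact: differentiable_derivable.
move/is_derive_line; rewrite (_ : (fun x => _) = cst (h q)); last first.
  by apply/funext => t; rewrite const.
by case=> _ <-; rewrite derive_cst.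
Qed.

Variable g : V -> V.
Hypotheses (g_isom : nil_isometry g) (g_or : orientation_preserving g).

Lemma isometry_C2 k : C2_on setT (fun q => g q 0 k).
Proof. by have [sg _ _] := g_isom; apply: smooth_coord_C2 => //; exact: openT. Qed.

Lemma isometry_differentiable p : differentiable g p.
Proof. by have [/(_ 1%N)[dg _] _ _] := g_isom; exact: dg. Qed.

Lemma isometry_cols p k l : (k < 3)%N -> (l < 3)%N ->
  dot3 ((fmatp g p)^~ k) ((fmatp g p)^~ l) = (k == l)%:R.
Proof.
move=> k3 l3; have [_ _ im] := g_isom.
by rewrite -nil_metric_frame_dot ?im ?nil_metric_orthonormal //; exact: isometry_differentiable.
Qed.

Lemma isometry_det p : det3 (fmatp g p) = 1.
Proof.
have pos : 0 < det3 (fmatp g p) by rewrite det_fmat //; exact: isometry_differentiable.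
suff : det3 (fmatp g p) ^+ 2 = 1.
  move/eqP; rewrite sqrf_eq1 => /orP[/eqP//|/eqP e]; move: pos; rewrite e; lra.
rewrite det3E; set A := \matrix_(i, j) _.
have /(congr1 determinant) : A^T *m A = 1%:M.
  by apply/matrixP => i j; rewrite !mxE sum3 !mxE; exact: (isometry_cols p (ltn_ord i) (ltn_ord j)).
by rewrite det_mulmx det_tr det1 -expr2.
Qed.

Let a p := fmatp g p.
Let d p (j n k : nat) := fr j (fmat g n k) p.

Let da n k p : differentiable (fmat g n k) p.
Proof. exact: differentiable_fmat isometry_C2 _ _ _ I. Qed.

Let skew p j k l : (j < 3)%N -> (k < 3)%N -> (l < 3)%N ->
  dot3 (d p j ^~ k) ((a p)^~ l) + dot3 ((a p)^~ k) (d p j ^~ l) = 0.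
Proof.
move=> j3 k3 l3.
pose t n q := fmat g n k q * fmat g n l q.
have dt n q : differentiable (t n) q by apply: differentiableM; exact: da.
have c : (fun q => t 0%N q + t 1%N q + t 2%N q) = cst (k == l)%:R.
  by apply/funext => q; rewrite -(isometry_cols q k3 l3).
have : fr j (fun q => t 0%N q + t 1%N q + t 2%N q) p = 0.
  by rewrite c; apply: fr_eq; exact: differentiable_cst.
rewrite frD; [|exact: (differentiableD (dt _ _) (dt _ _))|exact: dt].
rewrite frD; [|exact: dt|exact: dt].
rewrite /t !frM; try exact: da.
have alg (x0 x1 x2 y0 y1 y2 : R) :
  x0 + y0 + (x1 + y1) + (x2 + y2) = x0 + x1 + x2 + (y0 + y1 + y2) by ring.
by rewrite alg.
Qed.

Let curl p j n k : (j < 3)%N -> (n < 3)%N -> (k < 3)%N ->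
  d p j n k - d p k n j = bracket R j k * a p n 2%N - (n == 2%N)%:R *
    (a p 0%N j * a p 1%N k - a p 0%N k * a p 1%N j).
Proof. by move=> j3 n3 k3; exact: (@fmat_curl R setT g openT isometry_C2 j n k p I j3 n3 k3). Qed.

Let third p := third_row_derivative (isometry_cols p) (isometry_det p) (@skew p) (@curl p).

Lemma isometry_third_row p : fmat g 2 0 p = 0 /\ fmat g 2 1 p = 0.
Proof.
have h k (k3 : (k < 2)%N) q : fr 2 (fmat g 2 k) q = 0.
  apply: vertical_derivative_eq0 => // {}q.
  - have [t0 t1 _] := @third q 0 isT.
    by move: t0 t1; case: k k3 => [|[|//]] _; rewrite /d /= oppr0 !mul0r.
  - have [t0 t1 _] := @third q 1 isT.
    by move: t0 t1; case: k k3 => [|[|//]] _; rewrite /d /= oppr0 !mul0r.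
have [t0 t1 _] := @third p 2 isT; move: t0 t1; rewrite /d !h //= mulN1r mul1r.
by move=> /eqP; rewrite eq_sym oppr_eq0 => /eqP.
Qed.

Lemma isometry_fmat_derivative p j n k : (j < 3)%N -> (n < 3)%N -> (k < 3)%N ->
  fr j (fmat g n k) p = 0.
Proof.
move=> j3 n3 k3; have [z0 z1] := isometry_third_row p.
exact: (derivative_vertical_frame (isometry_cols p) (isometry_det p) (@skew p) (@curl p) j3 n3 k3 z0 z1).
Qed.

End Isometry.

#[local] Arguments fmat : simpl never.
#[local] Arguments fr : simpl never.

(** * Explicit form of the isometries *)

Section Motion.
Variable R : realType.
Local Notation V := 'rV[R]_3.
Local Notation P := 'rV[R]_6.
Implicit Types (h : V -> R) (p q : V) (u w : P).

(** Carrying differentiability together with the gradient lets polynomial expressions be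
    differentiated term by term; a function is then recognized from its gradient and its value at
    the origin. *)
Definition frame_gradient h (d : nat -> V -> R) : Prop :=
  forall q, differentiable h q /\ forall i, (i < 3)%N -> fr i h q = d i q.

Lemma frame_gradient_cst (c : R) : frame_gradient (fun=> c) (fun _ _ => 0).
Proof.
move=> q; split=> [|i i3]; first exact: differentiable_cst.
by apply: fr_eq; exact: differentiable_cst.
Qed.

Lemma frame_gradient_add f g df dg : frame_gradient f df -> frame_gradient g dg ->
  frame_gradient (fun q => f q + g q) (fun i q => df i q + dg i q).
Proof.
move=> hf hg q; have [f1 f2] := hf q; have [g1 g2] := hg q.
split=> [|i i3]; first exact: differentiableD.
by rewrite frD // f2 // g2.
Qed.

Lemma frame_gradient_mul f g df dg : frame_gradient f df -> frame_gradient g dg ->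
  frame_gradient (fun q => f q * g q) (fun i q => df i q * g q + f q * dg i q).
Proof.
move=> hf hg q; have [f1 f2] := hf q; have [g1 g2] := hg q.
split=> [|i i3]; first exact: differentiableM.
by rewrite frM // f2 // g2.
Qed.

Lemma frame_gradient_coord (k : 'I_3) :
  frame_gradient (fun q => q 0 k) (fun i q => frame i q 0 k).
Proof.
move=> q; split=> [|i i3]; first exact: differentiable_coord.
rewrite frE; last exact: differentiable_coord.
by rewrite (@derive_coord _ _ _ id) ?derive_id.
Qed.

Lemma frame_gradient_unique f g df dg : frame_gradient f df -> frame_gradient g dg ->
  (forall i q, (i < 3)%N -> df i q = dg i q) -> f 0 = g 0 -> f = g.
Proof.
move=> hf hg e e0; apply/funext => p.
pose h q := f q - g q.
have dh q : differentiable h q by apply: differentiableB; [have [] := hf q|have [] := hg q].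
have h0 i q : (i < 3)%N -> fr i h q = 0.
  move=> i3; have [f1 f2] := hf q; have [g1 g2] := hg q.
  by rewrite frB // f2 // g2 // e // subrr.
have z q : 'D_(dZ R) h q = 0 by exact: (h0 2 q isT).
have x q : 'D_(dX R) h q = 0 by exact: (h0 0 q isT).
have y q : 'D_(dY R) h q = 0 by have := h0 1 q isT; rewrite /fr z mulr0 addr0.
have D v q : 'D_v h q = 0.
  have -> : v = 1 *: (v 0 0 *: dX R + v 0 1 *: dY R) + v 0 2 *: dZ R.
    by apply: vec3_eq; rewrite !mxE /=; ring.
  by rewrite derive_linear // derive_linear // x y z !mulr0 !addr0 mulr0.
have [|c _] := @mvt_line _ _ h 0 p (fun=> 0) 1 ler01.
  by move=> t _; rewrite -(D p (0 + t *: p)); exact: differentiable_derivable.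
rewrite scale1r add0r mul0r /h e0 subrr subr0 => /eqP.
by rewrite subr_eq0 => /eqP.
Qed.

(* [u = (a, c, s, x0, y0, z0)]: the motion fixing the orientation whose
   linear part on the [(x, y)]-plane is [[a, - s c], [c, s a]]. *)
Definition motion u p : V :=
  let a := u 0 (inord 0) in let c := u 0 (inord 1) in let s := u 0 (inord 2) in
  let x0 := u 0 (inord 3) in let y0 := u 0 (inord 4) in let z0 := u 0 (inord 5) in
  let x := p 0 0 in let y := p 0 1 in let z := p 0 2 in
  vec3 (a * x + - (s * c) * y + x0) (c * x + s * a * y + y0)
    (s * z + a * c / 2 * (x * x) + - (s * c * c) * (x * y) + x0 * c * x +
     - (a * c / 2) * (y * y) + x0 * s * a * y + z0).

Definition motion_param u : Prop :=
  let a := u 0 (inord 0) in let c := u 0 (inord 1) in let s := u 0 (inord 2) in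
  a * a + c * c = 1 /\ s * s = 1.

(** For [a * a + c * c = 1] and [s = -1] this reflects the plane and reverses the fiber, so its
    determinant is 1 for both signs of [s]. *)
Definition plane_rotation (a c s : R) (n k : nat) : R :=
  match n, k with
  | 0%N, 0%N => a | 0%N, 1%N => - (s * c)
  | 1%N, 0%N => c | 1%N, 1%N => s * a
  | 2%N, 2%N => s | _, _ => 0
  end.

Section OneIsometry.
Variable g : V -> V.
Hypotheses (g_isom : nil_isometry g) (g_or : orientation_preserving g).

Lemma isometry_fmat : exists a c s : R, [/\ a * a + c * c = 1, s * s = 1 &
  forall n k p, (n < 3)%N -> (k < 3)%N -> fmat g n k p = plane_rotation a c s n k].
Proof.
have dfm n k q := differentiable_fmat (isometry_C2 g_isom) n k (I : setT q).
have const n k p : (n < 3)%N -> (k < 3)%N -> fmat g n k p = fmat g n k 0.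
  move=> n3 k3; pose b := fmat g n k 0; rewrite -/b.
  suff -> : fmat g n k = fun=> b by [].
  apply: (@frame_gradient_unique _ _ (fun _ _ => 0) (fun _ _ => 0)) => //.
    move=> q; split=> [|i i3]; first exact: dfm.
    exact: isometry_fmat_derivative.
  exact: frame_gradient_cst.
pose b n k := fmat g n k 0.
have [z0 z1] := isometry_third_row g_isom g_or 0.
have cols := isometry_cols g_isom 0; have rows := orthonormal_rows cols.
have [_ _ m2] := third_row rows (isometry_det g_isom g_or 0).
have c00 := cols 0%N 0%N isT isT; have c01 := cols 0%N 1%N isT isT.
have c22 := cols 2%N 2%N isT isT; have s2 := rows 2%N 2%N isT isT.
rewrite /dot3 /fmatp z0 mul0r addr0 in c00; rewrite /dot3 /fmatp z0 mul0r addr0 in c01.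
rewrite /dot3 /fmatp z0 z1 !mul0r !add0r in s2.
have [b02 b12 e01 e11] := rotation_entries m2 s2 c00 c01 c22.
exists (b 0%N 0%N), (b 1%N 0%N), (b 2%N 2%N); apply: And3 c00 s2 _.
move=> n k p n3 k3; rewrite (const _ _ _ n3 k3).
case: (lt3_cases n3) (lt3_cases k3) => -> [] ->.
- exact: (erefl (b 0%N 0%N)).
- exact: e01.
- exact: b02.
- exact: (erefl (b 1%N 0%N)).
- exact: e11.
- exact: b12.
- exact: z0.
- exact: z1.
- exact: (erefl (b 2%N 2%N)).
Qed.

Lemma isometry_motion : exists2 u, motion_param u & g = motion u.
Proof.
have [a [c [s [ac s2 gE]]]] := isometry_fmat.
pose u : P := \row_(i < 6) [:: a; c; s; g 0 0 0; g 0 0 1; g 0 0 2]`_i.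
have uE k : (k < 6)%N -> u 0 (inord k) = [:: a; c; s; g 0 0 0; g 0 0 1; g 0 0 2]`_k.
  by move=> k6; rewrite mxE inordK.
exists u; first by rewrite /motion_param !uE.
have dg k q : differentiable (fun q => g q 0 k) q.
  by have [] := isometry_C2 g_isom k (I : setT q).
have cst_ := @frame_gradient_cst.
have lin (k : 'I_3) (l m r : R) :
   (forall i q, (i < 3)%N -> fr i (fun q => g q 0 k) q = [:: l; m; 0]`_i) ->
   g 0 0 k = r -> (fun q => g q 0 k) = (fun q => l * q 0 0 + m * q 0 1 + r).
  move=> hg r0.
  apply: (@frame_gradient_unique _ _ (fun i q => [:: l; m; 0]`_i)).
  - by move=> q; split => // i i3; exact: hg.
  - apply: frame_gradient_add; last exact: cst_.
    apply: frame_gradient_add; apply: frame_gradient_mul; try exact: cst_;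
      exact: frame_gradient_coord.
  - by case=> [|[|[|//]]] q _; rewrite /frame /= !mxE /=; ring.
  - by rewrite r0 !mxE; ring.
have G0 : (fun q => g q 0 0) = fun q => a * q 0 0 + - (s * c) * q 0 1 + g 0 0 0.
  apply: lin => // i q i3; rewrite -[LHS]/(fmat g 0 i q) gE //.
  by case: i i3 => [|[|[|//]]].
have G1 : (fun q => g q 0 1) = fun q => c * q 0 0 + s * a * q 0 1 + g 0 0 1.
  apply: lin => // i q i3; rewrite -[LHS]/(fmat g 1 i q) gE //.
  by case: i i3 => [|[|[|//]]].
(* Row 2 of [fmat] is the pullback of [dz - x dy], so the gradient of the third coordinate is row 2
   plus [g q 0 0] times row 1. As the first coordinate is affine, this integrates to a quadratic
   polynomial. *)
have G2 : (fun q => g q 0 2) = fun q => s * q 0 2 + a * c / 2 * (q 0 0 * q 0 0) +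
    - (s * c * c) * (q 0 0 * q 0 1) + g 0 0 0 * c * q 0 0 +
     - (a * c / 2) * (q 0 1 * q 0 1) + g 0 0 0 * s * a * q 0 1 + g 0 0 2.
  have x := frame_gradient_coord 0; have y := frame_gradient_coord 1.
  have z := frame_gradient_coord 2.
  apply: (@frame_gradient_unique _ _
     (fun i q => plane_rotation a c s 2 i + g q 0 0 * plane_rotation a c s 1 i)).
  - move=> q; split => // i i3; rewrite -(gE 2 i q) // -(gE 1 i q) //.
    by rewrite /fmat subrK.
  - apply: frame_gradient_add; last exact: cst_.
    apply: frame_gradient_add; last by apply: frame_gradient_mul (cst_ _) y.
    apply: frame_gradient_add; last
      by apply: frame_gradient_mul (cst_ _) _; exact: (frame_gradient_mul y y).
    apply: frame_gradient_add; last by apply: frame_gradient_mul (cst_ _) x.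
    apply: frame_gradient_add; last
      by apply: frame_gradient_mul (cst_ _) _; exact: (frame_gradient_mul x y).
    apply: frame_gradient_add; last
      by apply: frame_gradient_mul (cst_ _) _; exact: (frame_gradient_mul x x).
    by apply: frame_gradient_mul (cst_ _) z.
  - move=> i q i3; have -> : g q 0 0 = a * q 0 0 + - (s * c) * q 0 1 + g 0 0 0.
      by have := congr1 (fun f => f q) G0.
    have aa : a * a = 1 - c * c by lra.
    have alg (x1 y1 w : R) : 0 + (a * x1 + - (s * c) * y1 + w) * (s * a) =
        s * (a * a) * x1 + - (s * s * (a * c)) * y1 + w * s * a by ring.
    by case: (lt3_cases i3) => ->; rewrite /frame /= ?mxE /= ?alg ?aa ?s2; field.
  - by rewrite !mxE; ring.
apply/funext => q; apply: vec3_eq; rewrite /motion !uE //= vec3E.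
- exact: (congr1 (fun f => f q) G0).
- exact: (congr1 (fun f => f q) G1).
- exact: (congr1 (fun f => f q) G2).
Qed.

End OneIsometry.
End Motion.

(** * Proper discontinuity *)

Section Proper.
Variable R : realType.
Local Notation V := 'rV[R]_3.
Local Notation P := 'rV[R]_6.
Implicit Types (p q : V) (u w : P).

Lemma continuous_vec3 (T : topologicalType) (f g h : T -> R) (t : T) :
  {for t, continuous f} -> {for t, continuous g} -> {for t, continuous h} ->
  {for t, continuous (fun x => vec3 (f x) (g x) (h x))}.
Proof.
move=> cf cg ch.
have -> : (fun x => vec3 (f x) (g x) (h x)) =
    fun x => f x *: dX R + g x *: dY R + h x *: dZ R.
  by apply/funext => x; apply: vec3_eq; rewrite !mxE /=; ring.
apply: (@continuousD _ _ _ (fun x => f x *: dX R + g x *: dY R) (fun x => h x *: dZ R)).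
  apply: (@continuousD _ _ _ (fun x => f x *: dX R) (fun x => g x *: dY R)).
    exact: cvgZr_tmp.
  exact: cvgZr_tmp.
exact: cvgZr_tmp.
Qed.

Lemma continuous_motion_formula (T : topologicalType)
    (a c s x0 y0 z0 x y z : T -> R) (t : T) :
  {for t, continuous a} -> {for t, continuous c} -> {for t, continuous s} ->
  {for t, continuous x0} -> {for t, continuous y0} -> {for t, continuous z0} ->
  {for t, continuous x} -> {for t, continuous y} -> {for t, continuous z} ->
  {for t, continuous (fun t => vec3
    (a t * x t + - (s t * c t) * y t + x0 t) (c t * x t + s t * a t * y t + y0 t)
    (s t * z t + a t * c t / 2 * (x t * x t) + - (s t * c t * c t) * (x t * y t) +
     x0 t * c t * x t + - (a t * c t / 2) * (y t * y t) + x0 t * s t * a t * y t + z0 t))}.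
Proof.
move=> ha hc hs hx0 hy0 hz0 hx hy hz.
have K k : {for t, continuous (fun _ : T => k : R)} by exact: cst_continuous.
have N (h : T -> R) : {for t, continuous h} -> {for t, continuous (fun t => - h t)}.
  exact: continuousN.
have ac2 := continuous_mul (continuous_mul ha hc) (K (2^-1)).
have sc := continuous_mul hs hc.
apply: continuous_vec3.
- exact (continuous_add (continuous_add (continuous_mul ha hx) (continuous_mul (N _ sc) hy)) hx0).
- exact (continuous_add (continuous_add (continuous_mul hc hx)
    (continuous_mul (continuous_mul hs ha) hy)) hy0).
- have t1 := continuous_mul ac2 (continuous_mul hx hx).
  have t2 := continuous_mul (N _ (continuous_mul sc hc)) (continuous_mul hx hy).
  have t3 := continuous_mul (continuous_mul hx0 hc) hx.
  have t4 := continuous_mul (N _ ac2) (continuous_mul hy hy).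
  have t5 := continuous_mul (continuous_mul (continuous_mul hx0 hs) ha) hy.
  exact (continuous_add (continuous_add (continuous_add (continuous_add (continuous_add
    (continuous_add (continuous_mul hs hz) t1) t2) t3) t4) t5) hz0).
Qed.

Lemma continuous_motion (T : topologicalType) (f : T -> P) (g : T -> V) :
  continuous f -> continuous g -> continuous (fun t => motion (f t) (g t)).
Proof.
move=> cf cg t.
have U (i : 'I_6) : {for t, continuous (fun t => f t 0 i)}.
  by apply: (@continuous_comp _ _ _ f (fun M : P => M 0 i)); [exact: cf|exact: coord_continuous].
have X (i : 'I_3) : {for t, continuous (fun t => g t 0 i)}.
  by apply: (@continuous_comp _ _ _ g (fun M : V => M 0 i)); [exact: cg|exact: coord_continuous].
exact: (continuous_motion_formula (U _) (U _) (U _) (U _) (U _) (U _) (X _) (X _) (X _)).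
Qed.

Definition motion_compact (B : R) : set P := [set u | forall i, `[- B, B]%classic (u 0 i)].

Lemma compact_motion_compact B : compact (motion_compact B).
Proof. by apply: (@rV_compact R 6 (fun=> `[- B, B]%classic)) => i; exact: segment_compact. Qed.

(** The linear parameters have absolute value at most 1, and the formula for [motion] can be solved
    for the translation parameters in terms of [p] and its image. *)
Lemma motion_bounded (r : R) : exists B, forall u p, motion_param u ->
  `|p| <= r -> `|motion u p| <= r -> motion_compact B u.
Proof.
pose bd (x y : R) := `|x| <= y.
have bD x y a b : bd x a -> bd y b -> bd (x + y) (a + b).
  by move=> h1 h2; apply: le_trans (ler_normD _ _) (lerD h1 h2).
have bN x a : bd x a -> bd (- x) a by rewrite /bd normrN.
have bM x y a b : bd x a -> bd y b -> bd (x * y) (a * b).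
  by move=> h1 h2; rewrite /bd normrM ler_pM.
have coord (v : V) i : `|v| <= r -> bd (v 0 i) r.
  move=> vr; apply: le_trans vr; rewrite [leRHS]/Num.Def.normr /= mx_normrE.
  by apply: le_trans (le_bigmax _ _ (0, i)).
have unit (x y : R) : x * x + y * y = 1 -> bd x 1.
  move=> e; have y0 := sqr_ge0 y; rewrite expr2 in y0.
  by rewrite /bd -(@ler_pXn2r _ 2) // ?nnegrE // real_normK ?num_real // expr1n expr2; lra.
have [b0 [b1 [b2 H]]] : exists b0 b1 b2, forall a c s x0 y0 z0 x y z x' y' z',
    bd a 1 -> bd c 1 -> bd s 1 -> bd x r -> bd y r -> bd z r ->
    bd x' r -> bd y' r -> bd z' r ->
    x' = a * x + - (s * c) * y + x0 -> y' = c * x + s * a * y + y0 ->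
    z' = s * z + a * c / 2 * (x * x) + - (s * c * c) * (x * y) +
     x0 * c * x + - (a * c / 2) * (y * y) + x0 * s * a * y + z0 ->
    [/\ bd x0 b0, bd y0 b1 & bd z0 b2].
  have h : bd (2^-1) 1 by rewrite /bd ger0_norm; lra.
  (* The three bounds stay undetermined here; decomposing the solved expressions into sums and
     products with [bD], [bM], [bN] builds them. *)
  do 3 eexists; move=> a c s x0 y0 z0 x y z x' y' z' ha hc hs hx hy hz hx' hy' hz' ex ey ez.
  have {}ex : x0 = x' + - (a * x + - (s * c) * y) by rewrite ex; ring.
  have {}ey : y0 = y' + - (c * x + s * a * y) by rewrite ey; ring.
  have {}ez : z0 = z' + - (s * z + a * c / 2 * (x * x) + - (s * c * c) * (x * y) +
     (x' + - (a * x + - (s * c) * y)) * c * x + - (a * c / 2) * (y * y) +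
     (x' + - (a * x + - (s * c) * y)) * s * a * y) by rewrite ez -ex; ring.
  rewrite ez ey ex {ex ey ez}.
  by split; repeat first [eassumption|eapply bD|eapply bM|eapply bN].
pose B := 1 + `|b0| + `|b1| + `|b2|.
have bB x b : bd x b -> b <= B -> `[- B, B]%classic x.
  move=> xb bB'; rewrite /= in_itv /=; rewrite -ler_norml; exact: le_trans bB'.
have := normr_ge0 b0; have := normr_ge0 b1; have := normr_ge0 b2.
have := ler_norm b0; have := ler_norm b1; have := ler_norm b2 => h2 h1 h0 n2 n1 n0.
exists B => u p [acu ssu] pr mr.
have ha := unit _ _ acu; have hc : bd (u 0 (inord 1)) 1 by apply: unit; rewrite addrC; exact: acu.
have hs : bd (u 0 (inord 2)) 1 by apply: (unit _ 0); rewrite mulr0 addr0.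
have [h3 h4 h5] := H _ _ _ (u 0 (inord 3)) (u 0 (inord 4)) (u 0 (inord 5)) _ _ _ _ _ _
  ha hc hs (coord p 0 pr) (coord p 1 pr) (coord p 2 pr) (coord _ 0 mr) (coord _ 1 mr)
  (coord _ 2 mr) (vec3E0 _ _ _) (vec3E1 _ _ _) (vec3E2 _ _ _).
have le1 : 1 <= B by rewrite /B; lra.
have le0 : b0 <= B by rewrite /B; lra.
have le2 : b1 <= B by rewrite /B; lra.
have le3 : b2 <= B by rewrite /B; lra.
move=> i; rewrite -(inord_val i); case: i => [[|[|[|[|[|[|//]]]]]] k] /=.
- exact: bB ha le1.
- exact: bB hc le1.
- exact: bB hs le1.
- exact: bB h3 le0.
- exact: bB h4 le2.
- exact: bB h5 le3.
Qed.

Lemma isolated_id_compact_open (G : transf_group V) : discrete_group G ->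
  exists2 N : set {compact-open, V -> V}, nbhs (id : {compact-open, V -> V}) N &
    forall g, G g -> N g -> g = id.
Proof.
move=> dG; have [_ [N nN NG]] := dG id (transf_id G).
exists N => // g Gg Ng.
by have : (N `&` [set g | G g]) g by []; rewrite NG.
Qed.

Lemma properly_discontinuous (G : transf_group V) p :
  (forall g, G g -> nil_isometry g) -> (forall g, G g -> orientation_preserving g) ->
  discrete_group G -> acts_freely G ->
  exists2 W, nbhs p W & forall g q, G g -> W q -> W (g q) -> g = id.
Proof.
(* Otherwise the parameters of [(g^-1, g)], for elements [g <> id] moving points near [p] to
   points near [p], accumulate. Two such elements [g], [k] near the limit have [g^-1 k] near
   [id], hence [k = g]; but [k] can be chosen to move [p] less than [g] does. *)
move=> Gi Go dG fG; apply: contrapT => noW.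
pose S (W : set V) : set (P * P) := [set w | exists g h, [/\ G g, G h, cancel g h & g <> id] /\
  [/\ motion_param w.1, motion_param w.2, g = motion w.2, h = motion w.1 &
      exists2 q, W q & W (g q)]].
have S_mono W W' : W `<=` W' -> S W `<=` S W'.
  move=> WW' w [g [h [H [h1 h2 h3 h4 [q Wq Wgq]]]]].
  by exists g, h; split => //; split => //; exists q; apply: WW'.
pose F := filter_from (nbhs p) S.
have FF : ProperFilter F.
  apply: filter_from_proper; last first.
    move=> W nW; apply: contrapT => S0; apply: noW; exists W => // g q Gg Wq Wgq.
    apply: contrapT => gid; apply: S0.
    have [h [Gh gh _]] := transf_inv Gg.
    have [u mu gu] := isometry_motion (Gi _ Gg) (Go _ Gg).
    have [u' mu' hu'] := isometry_motion (Gi _ Gh) (Go _ Gh).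
    by exists (u', u), g, h; split => //; split => //; exists q.
  apply: filter_from_filter; first by exists setT; exact: filterT.
  move=> W W' nW nW'; exists (W `&` W'); first exact: filterI.
  by move=> w SW; split; apply: S_mono SW => q [].
have [B HB] := motion_bounded (`|p| + 1).
pose K := motion_compact B `*` motion_compact B.
have cK : compact K by apply: compact_setX; exact: compact_motion_compact.
(* An element and its inverse both send some point of the unit ball around [p] into that ball, so
   both parameter vectors are bounded. *)
have FK : F K.
  exists (ball p 1); first exact: nbhsx_ballx.
  have nb q : ball p 1 q -> `|q| <= `|p| + 1.
    rewrite -ball_normE /= => /ltW pq; have := ler_normB p (p - q).
    by rewrite opprB addrC subrK => /le_trans; apply; rewrite lerD2l.
  move=> w [g [h [[_ _ gh _] [m1 m2 gE hE [q /nb Wq /nb Wgq]]]]]; split.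
    by apply: (HB _ (g q)) => //; rewrite -hE gh.
  by apply: (HB _ q) => //; rewrite -gE.
have [[u' u] [_ cl]] := cK F FF FK.
pose Psi (wx : (P * P) * V) := motion wx.1.1 (motion wx.1.2 wx.2).
have cPsi : continuous Psi.
  apply: continuous_motion; last apply: continuous_motion.
  - by move=> x; apply: (@continuous_comp _ _ _ fst fst); exact: cvg_fst.
  - by move=> x; apply: (@continuous_comp _ _ _ fst snd); [exact: cvg_fst|exact: cvg_snd].
  - by move=> x; exact: cvg_snd.
(* Joint continuity in parameters and point becomes continuity of the parametrization into the
   compact-open topology, where discreteness is stated. *)
have [ccur _] := continuous_curry cPsi.
(* Every pair in the filter composes to the identity; this is a closed condition at each point, so
   it passes to the cluster point. *)
have cid_ : curry Psi (u', u) = id.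
  apply/funext => x; apply: contrapT => ne.
  have cx : continuous (fun w : P * P => curry Psi w x).
    move=> w; apply: (@continuous_comp _ _ _ (fun w : P * P => (w, x)) Psi); last exact: cPsi.
    rewrite /prop_for /continuous_at.
    by apply: (@cvg_pair _ _ _ (nbhs w) (nbhs w) (nbhs x) _ _ _ id (fun=> x)); [exact: cvg_id|exact: cvg_cst].
  have nN : nbhs (u', u) [set w | curry Psi w x != x].
    have oV : open [set y : V | y != x].
      have -> : [set y : V | y != x] = ~` [set x].
        by apply/seteqP; split => y /= /eqP.
      by apply: closed_openC; apply: accessible_closed_set1; exact: hausdorff_accessible (@norm_hausdorff _ _).
    have nV : nbhs (curry Psi (u', u) x) [set y : V | y != x].
      by apply: open_nbhs_nbhs; split => //; exact/eqP.
    exact: (cx (u', u) _ nV).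
  have FS : F (S setT) by exists setT => //; exact: filterT.
  have [[w' w] [[g [h [[_ _ gh _] [_ _ gE hE _]]]] /eqP]] := cl _ _ FS nN.
  by apply; rewrite /curry /Psi /= -gE -hE gh.
have [N nN NG] := isolated_id_compact_open dG.
have nC : nbhs (u', u) (curry Psi @^-1` N).
  by have := ccur (u', u); rewrite /continuous_at cid_; apply.
(* A product neighbourhood allows the inverse of one element to be paired with a different
   element. *)
have [[N1 N2] /= [n1 n2] N12] := nC.
have nX : nbhs (u', u) (N1 `*` N2) by exists (N1, N2).
have FS : F (S setT) by exists setT => //; exact: filterT.
have [[v' v] [[g [h [[Gg Gh gh gid] [_ _ gE hE _]]]] [Nv' Nv]]] := cl _ _ FS nX.
have gp : g p != p by apply/eqP => /(fG _ _ Gg).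
have cg : continuous g.
  by move=> q; apply: differentiable_continuous; exact: (isometry_differentiable (Gi _ Gg)).
have e0 : 0 < `|g p - p| / 2 by rewrite divr_gt0 // normr_gt0 subr_eq0.
(* If [g] moved a point [q] of [W] into [W], passing through [g q] would make the distance from
   [g p] to [p] smaller than itself. *)
pose W : set V := [set q | `|g p - g q| < `|g p - p| / 2] `&` [set q | `|p - q| < `|g p - p| / 2].
have nW : nbhs p W.
  apply: filterI; last by have /cvgrPdist_lt := @cvg_id _ (nbhs p); apply.
  by have /cvgrPdist_lt := cg p; apply.
have FW : F (S W) by exists W.
have [[w' w] [[k [_ [[Gk _ _ _] [_ _ kE _ [q [/= Wq _] [_ /= Wkq]]]]]] [Nw' Nw]]] := cl _ _ FW nX.
have hk : h \o k = id.
  apply: NG; first exact: transf_comp.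
  have -> : h \o k = curry Psi (v', w) by apply/funext => x; rewrite hE kE.
  by apply: (N12 (v', w)).
have kg : k = g.
  apply/funext => x; have [h' [_ hh' h'h]] := transf_inv Gh.
  have := congr1 (fun f => f x) hk; rewrite /= -[in RHS](gh x).
  by move/(can_inj hh').
rewrite kg in Wkq; rewrite distrC in Wkq.
have := ler_normD (g p - g q) (g q - p); rewrite addrA subrK => tri.
have := le_lt_trans tri (ltrD Wq Wkq); rewrite -splitr ltxx.
by [].
Qed.

End Proper.

(** * Chain rule in the moving frames *)

Section Chain.
Variable R : realType.
Local Notation V := 'rV[R]_3.
Implicit Types (p q : V) (h : V -> R) (F g : V -> V).

Lemma diff_frame g q i : differentiable g q ->
  'd g q (frame i q) = fmat g 0 i q *: frame 0 (g q) + fmat g 1 i q *: frame 1 (g q)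
    + fmat g 2 i q *: frame 2 (g q).
Proof.
by move=> dg; rewrite /fmat !fr_coord //; apply: vec3_eq; rewrite /frame !mxE /=; ring.
Qed.

Lemma fr_comp h g q i : differentiable h (g q) -> differentiable g q ->
  fr i (fun x => h (g x)) q = fr 0 h (g q) * fmat g 0 i q + fr 1 h (g q) * fmat g 1 i q
    + fr 2 h (g q) * fmat g 2 i q.
Proof.
move=> dh dg; have dc : differentiable (fun x => h (g x)) q.
  exact: (@differentiable_comp _ _ _ _ g h).
rewrite (frE i dc) (deriveE _ dc) (@diff_comp _ _ _ _ g h) //=.
by rewrite diff_frame // !linearD !linearZ /= !(frE _ dh) !deriveE // ![_ *: _]mulrC.
Qed.

Lemma fmat_comp F g q n i : (n < 3)%N -> differentiable F (g q) -> differentiable g q ->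
  fmat (F \o g) n i q = fmat F n 0 (g q) * fmat g 0 i q + fmat F n 1 (g q) * fmat g 1 i q
    + fmat F n 2 (g q) * fmat g 2 i q.
Proof.
move=> n3 dF dg.
have c k := @fr_comp (fun x => F x 0 k) g q i (differentiable_coord_comp k dF) dg.
have [->|->|->] := lt3_cases n3.
- exact: c.
- exact: c.
- rewrite {1}/fmat [(F \o g) _]/= [fr i (fun q => (F \o g) q 0 2) q]c.
  rewrite [fr i (fun q => (F \o g) q 0 1) q]c [fmat F 2 0 _]/fmat [fmat F 2 1 _]/fmat
    [fmat F 2 2 _]/fmat.
  have alg (a0 a1 a2 b0 b1 b2 x y0 y1 y2 : R) :
    a0 * y0 + a1 * y1 + a2 * y2 - x * (b0 * y0 + b1 * y1 + b2 * y2) =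
    (a0 - x * b0) * y0 + (a1 - x * b1) * y1 + (a2 - x * b2) * y2 by ring.
  exact: alg.
Qed.

Lemma fmat_near F F' p n i : (\near p, F p = F' p) -> fmat F n i p = fmat F' n i p.
Proof.
move=> FF'; have e k : fr i (fun q => F q 0 k) p = fr i (fun q => F' q 0 k) p.
  by apply: fr_near; apply: filterS FF' => q ->.
by case: n => [|[|n]]; rewrite /fmat !e // (nbhs_singleton FF').
Qed.

Lemma fmat_id n k p : (n < 3)%N -> (k < 3)%N -> fmat id n k p = plane_rotation (1 : R) 0 1 n k.
Proof.
move=> n3 k3.
have e (l : 'I_3) : fr k (fun q : V => id q 0 l) p = frame k p 0 l.
  exact: ((frame_gradient_coord l p).2 k k3).
by have [->|->|->] := lt3_cases n3; move: e; have [->|->|->] := lt3_cases k3 => e;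
  rewrite /fmat ?e /frame /dX /dZ ?vec3E /=; ring.
Qed.

End Chain.

(** * Lifts of a Legendrian diffeomorphism *)

Section Lifts.
Variables (R : realType) (G : transf_group 'rV[R]_3).
Local Notation V := 'rV[R]_3.
Local Notation M := (orbit_space G).
Hypotheses (G_isom : forall g, G g -> nil_isometry g)
  (G_orient : forall g, G g -> orientation_preserving g)
  (G_discrete : discrete_group G) (G_free : acts_freely G).
Implicit Types (p q : V) (F : V -> V) (U : set V).

Lemma group_continuous g : G g -> continuous g.
Proof.
move=> Gg q; apply: differentiable_continuous; exact: (isometry_differentiable (G_isom Gg)).
Qed.

(** Take [g] with [g (H1 p) = H2 p]. If [k] carries [H1 q] to [H2 q] for [q] near [p], then [k]
    composed with the inverse of [g] moves a point of a small neighbourhood of [H2 p] inside it, so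
    [k = g]. *)
Lemma lift_unique (H1 H2 : V -> V) p : {for p, continuous H1} -> {for p, continuous H2} ->
  (\forall q \near p, orbit_pi G (H1 q) = orbit_pi G (H2 q)) ->
  exists2 g, G g & \forall q \near p, H2 q = g (H1 q).
Proof.
move=> c1 c2 e; have [g Gg gp] := (orbit_piP G _ _).1 (nbhs_singleton e).
exists g => //.
have [W nW HW] := properly_discontinuous (H2 p) G_isom G_orient G_discrete G_free.
have n2 : nbhs p (H2 @^-1` W) by exact: c2.
have n1 : nbhs p ((g \o H1) @^-1` W).
  have : {for p, continuous (g \o H1)} by apply: continuous_comp => //; exact: group_continuous.
  by apply; rewrite /= gp.
have [h [Gh gh hg]] := transf_inv Gg.
apply: filterS (filterI e (filterI n1 n2)) => q [eq [W1 W2]].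
have [k Gk kq] := (orbit_piP G _ _).1 eq.
have kh : k \o h = id.
  apply: (HW _ (g (H1 q))) => //; first exact: transf_comp.
  by rewrite /= gh kq.
by rewrite -kq; have := congr1 (fun f => f (g (H1 q))) kh; rewrite /= gh.
Qed.

Lemma group_rotation g : G g -> exists a c s : R, [/\ a * a + c * c = 1, s * s = 1 &
  forall n k p, (n < 3)%N -> (k < 3)%N -> fmat g n k p = plane_rotation a c s n k].
Proof. by move=> Gg; exact: isometry_fmat (G_isom Gg) (G_orient Gg). Qed.

Variable f : M -> M.

Lemma lift_C2 U F k : local_lift f U F -> C2_on U (fun q => F q 0 k).
Proof. by move=> [oU sF _]; exact: smooth_coord_C2. Qed.

Lemma lift_differentiable U F p : local_lift f U F -> U p -> differentiable F p.
Proof. by move=> [_ /(_ 1%N)[dF _] _]; exact: dF. Qed.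

Lemma lift_transform U F U' F' g p : local_lift f U F -> local_lift f U' F' -> G g ->
  U p -> U' (g p) -> exists2 h, G h & \forall q \near p, F q = h (F' (g q)).
Proof.
move=> lF lF' Gg Up Up'; have [oU _ eF] := lF; have [oU' _ eF'] := lF'.
have cg := group_continuous Gg.
have nU' : nbhs p (g @^-1` U') by apply: cg; exact: open_nbhs_nbhs.
apply: (@lift_unique (F' \o g) F).
- apply: continuous_comp; first exact: cg.
  exact/differentiable_continuous/(lift_differentiable lF').
- exact/differentiable_continuous/(lift_differentiable lF).
- apply: filterS (filterI (open_nbhs_nbhs (conj oU Up)) nU') => q [Uq Uq'].
  rewrite /= eF' // eF //; congr f; apply/esym/orbit_piP.
  by exists g.
Qed.

Hypothesis f_leg : legendrian f.

Lemma legendrian_fmat U F p : local_lift f U F -> U p -> fmat F 2 2 p = 0.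
Proof.
move=> lF Up; have [_ _ /(_ U F p lF Up) sub] := f_leg.
have dF := lift_differentiable lF Up.
have : contact_plane (F p) ('d F p (dZ R)).
  by apply: sub; exists (dZ R) => //; exists 1; rewrite scale1r.
rewrite /fmat !fr_coord // [frame 2 p]/= => -[x [y ->]].
rewrite /nil_frame /= !mxE /=; ring.
Qed.

Hypothesis f_diff : diffeomorphism f.

(** Composing with a local lift of the inverse diffeomorphism gives a lift of the identity, which is
    locally an element of [G] and so has determinant 1. *)
Lemma diffeomorphism_det U F p : local_lift f U F -> U p -> det3 (fmatp F p) != 0.
Proof.
move=> lF Up; have dF := lift_differentiable lF Up.
have [_ [k [sk fk kf]]] := f_diff.
have [U' [L [Up' lL]]] := sk (F p).
have [oU _ eF] := lF; have [oU' _ eL] := lL.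
have dL : differentiable L (F p) by have [_ /(_ 1%N)[dL _] _] := lL; exact: dL.
have cF : {for p, continuous F} by exact: differentiable_continuous.
have [|||g Gg eg] := @lift_unique id (L \o F) p.
- exact: cvg_id.
- by apply: continuous_comp => //; exact: differentiable_continuous.
- have nU' : nbhs p (F @^-1` U') by apply: cF; exact: open_nbhs_nbhs.
  apply: filterS (filterI (open_nbhs_nbhs (conj oU Up)) nU') => q [Uq Uq'].
  by rewrite /= eL // eF // fk.
apply/eqP => d0.
have : det3 (fmatp (L \o F) p) = 0.
  rewrite det3E (_ : \matrix_(i, j) _ = (\matrix_(i < 3, j < 3) fmatp L (F p) i j) *m
     (\matrix_(i < 3, j < 3) fmatp F p i j)).
    by rewrite det_mulmx -!det3E d0 mulr0.
  by apply/matrixP => i j; rewrite !mxE sum3 !mxE; exact: fmat_comp.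
have -> : det3 (fmatp (L \o F) p) = det3 (fmatp g p).
  by rewrite !det3E; congr (\det _); apply/matrixP => i j; rewrite !mxE; exact: fmat_near.
by rewrite (isometry_det (G_isom Gg) (G_orient Gg)) => /eqP; rewrite oner_eq0.
Qed.

(* Real and imaginary parts of [(a + i b)^2], where [(a, b)] is the horizontal part of
   [F^*(dz - x dy)]; squaring removes the dependence of its sign on the lift. *)
Definition psi1 F q : R := fmat F 2 0 q * fmat F 2 0 q - fmat F 2 1 q * fmat F 2 1 q.
Definition psi2 F q : R := 2 * (fmat F 2 0 q * fmat F 2 1 q).

(** Near [p], [F] is [h \o F' \o g] with [h] in [G]. The factor [h] multiplies the third row by a
    sign, which squaring removes; [g] acts through the doubled angle, with cosine [a * a - c * c]
    and sine [2 * a * c], and by conjugation when [s = -1]. *)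
Lemma psi_transform U F U' F' g p (a c s : R) : local_lift f U F -> local_lift f U' F' -> G g ->
  U p -> U' (g p) -> s * s = 1 ->
  (forall n k p, (n < 3)%N -> (k < 3)%N -> fmat g n k p = plane_rotation a c s n k) ->
  psi1 F p = (a * a - c * c) * psi1 F' (g p) + 2 * a * c * psi2 F' (g p) /\
  psi2 F p = s * (- (2 * a * c) * psi1 F' (g p) + (a * a - c * c) * psi2 F' (g p)).
Proof.
move=> lF lF' Gg Up Up' ss gE.
have [h Gh hE] := lift_transform lF lF' Gg Up Up'.
have [a' [c' [s' [_ ss' hrot]]]] := group_rotation Gh.
have dg : differentiable g p by exact: (isometry_differentiable (G_isom Gg)).
have dF' : differentiable F' (g p) by exact: lift_differentiable lF' Up'.
have dFg : differentiable (F' \o g) p by exact: differentiable_comp.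
have e k : (k < 3)%N -> fmat F 2 k p = s' * (fmat F' 2 0 (g p) * plane_rotation a c s 0 k +
    fmat F' 2 1 (g p) * plane_rotation a c s 1 k).
  move=> k3; rewrite (fmat_near 2 k (F' := h \o (F' \o g))) //.
  rewrite (@fmat_comp _ h (F' \o g)) //; last exact: (isometry_differentiable (G_isom Gh)).
  rewrite !hrot // [plane_rotation _ _ _ 2 0]/= [plane_rotation _ _ _ 2 1]/=.
  rewrite [plane_rotation _ _ _ 2 2]/= !mul0r !add0r fmat_comp // !gE //.
  by rewrite (legendrian_fmat lF' Up') mul0r addr0.
rewrite /psi1 /psi2 !e //=.
move: (fmat F' 2 0 (g p)) (fmat F' 2 1 (g p)) => A B; split.
- transitivity (s' * s' * (A * a + B * c) * (A * a + B * c) -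
     s' * s' * (s * s) * (A * - c + B * a) * (A * - c + B * a)); first by ring.
  by rewrite ss ss'; ring.
- transitivity (2 * (s' * s') * s * (A * a + B * c) * (A * - c + B * a)); first by ring.
  by rewrite ss'; ring.
Qed.

Lemma differentiable_psi U F p : local_lift f U F -> U p ->
  differentiable (psi1 F) p /\ differentiable (psi2 F) p.
Proof.
move=> lF Up; have [oU _ _] := lF.
have d k := differentiable_fmat (fun k => lift_C2 k lF) 2 k Up.
split.
  apply: (@differentiableB _ _ _ (fun q => fmat F 2 0 q * fmat F 2 0 q)
    (fun q => fmat F 2 1 q * fmat F 2 1 q)); apply: differentiableM; exact: d.
apply: (@differentiableM _ _ (fun=> 2) (fun q => fmat F 2 0 q * fmat F 2 1 q)).
  exact: differentiable_cst.
by apply: differentiableM; exact: d.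
Qed.

Lemma fr_psi U F p i : local_lift f U F -> U p ->
  fr i (psi1 F) p = 2 * (fmat F 2 0 p * fr i (fmat F 2 0) p - fmat F 2 1 p * fr i (fmat F 2 1) p)
  /\
  fr i (psi2 F) p = 2 * (fr i (fmat F 2 0) p * fmat F 2 1 p + fmat F 2 0 p * fr i (fmat F 2 1) p).
Proof.
move=> lF Up; have d k := differentiable_fmat (fun k => lift_C2 k lF) 2 k Up.
have m k l := frM i (d k) (d l).
have dm k l : differentiable (fun q => fmat F 2 k q * fmat F 2 l q) p.
  by apply: differentiableM; exact: d.
split; first by rewrite /psi1 frB // !m; ring.
have c0 : fr i (fun=> 2) p = 0 by apply: fr_eq; exact: differentiable_cst.
apply: etrans (frM i (f := fun=> 2) (differentiable_cst _ p) (dm 0%N 1%N)) _.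
by rewrite c0 mul0r add0r m.
Qed.

Lemma continuous_fr_psi U F p i : local_lift f U F -> U p ->
  {for p, continuous (fr i (psi1 F))} /\ {for p, continuous (fr i (psi2 F))}.
Proof.
move=> lF Up; have [oU _ _] := lF; have nU := open_nbhs_nbhs (conj oU Up).
have d k : {for p, continuous (fmat F 2 k)}.
  apply: differentiable_continuous; exact: (differentiable_fmat (fun k => lift_C2 k lF) 2 k Up).
have dd k : {for p, continuous (fr i (fmat F 2 k))}.
  exact: (fmat_fr_continuous oU (fun k => lift_C2 k lF) Up).
have two : {for p, continuous (fun _ : V => 2 : R)} by exact: cst_continuous.
split.
  apply: near_eq_continuous.
    by apply: filterS nU => q Uq; apply/esym; have [-> _] := fr_psi i lF Uq.
  exact (continuous_mul two (continuous_sub (continuous_mul (d 0) (dd 0)) (continuous_mul (d 1%N) (dd 1%N)))).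
apply: near_eq_continuous.
  by apply: filterS nU => q Uq; apply/esym; have [_ ->] := fr_psi i lF Uq.
exact (continuous_mul two (continuous_add (continuous_mul (dd 0) (d 1%N)) (continuous_mul (d 0) (dd 1%N)))).
Qed.

(** With [(A, B)] the horizontal part, the two quantities are [(A^2 + B^2)^2] and
    [2 (A^2 + B^2) (A * Z B - B * Z A)]. The last factor is the determinant, and [A = B = 0] would
    make it vanish. *)
Lemma psi_nondegenerate U F p : local_lift f U F -> U p ->
  0 < psi1 F p * psi1 F p + psi2 F p * psi2 F p /\
  psi1 F p * fr 2 (psi2 F) p - psi2 F p * fr 2 (psi1 F) p != 0.
Proof.
move=> lF Up; have [oU _ _] := lF.
have := diffeomorphism_det lF Up.
have [-> ->] := fr_psi 2 lF Up; rewrite /psi1 /psi2 /det3 /fmatp.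
have z2 := legendrian_fmat lF Up.
have zd j : fr j (fmat F 2 2) p = 0.
  rewrite (@fr_near _ j (fmat F 2 2) (fun=> 0)); first by apply: fr_eq; exact: differentiable_cst.
  by apply: filterS (open_nbhs_nbhs (conj oU Up)) => q; exact: legendrian_fmat.
have := fmat_curl oU (fun k => lift_C2 k lF) Up (isT : (2 < 3)%N) (isT : (2 < 3)%N) (isT : (0 < 3)%N).
have := fmat_curl oU (fun k => lift_C2 k lF) Up (isT : (2 < 3)%N) (isT : (2 < 3)%N) (isT : (1 < 3)%N).
rewrite !zd !subr0 z2.
move: (fmat F 0 0 p) (fmat F 0 1 p) (fmat F 0 2 p) (fmat F 1 0 p) (fmat F 1 1 p) (fmat F 1 2 p).
move: (fmat F 2 0 p) (fmat F 2 1 p) (fr 2 (fmat F 2 0) p) (fr 2 (fmat F 2 1) p).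
move=> A B A2 B2 x0 x1 x2 y0 y1 y2; rewrite /bracket /= => eB eA dn.
have dE : x0 * (y1 * 0 - y2 * B) - x1 * (y0 * 0 - y2 * A) + x2 * (y0 * B - y1 * A) =
   A * B2 - B * A2 by rewrite eA eB; ring.
rewrite dE in dn.
have pos : 0 < A * A + B * B.
  rewrite lt_neqAle addr_ge0 ?andbT -?expr2 ?sqr_ge0 //.
  apply: contra_neq dn => /esym/eqP; rewrite paddr_eq0 ?sqr_ge0 // !sqrf_eq0.
  by move=> /andP[/eqP -> /eqP ->]; rewrite !mul0r subrr.
split.
  have -> : (A * A - B * B) * (A * A - B * B) + 2 * (A * B) * (2 * (A * B)) =
    (A * A + B * B) * (A * A + B * B) by ring.
  exact: mulr_gt0.
have -> : (A * A - B * B) * (2 * (A2 * B + A * B2)) - 2 * (A * B) * (2 * (A * A2 - B * B2)) =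
  2 * (A * A + B * B) * (A * B2 - B * A2) by ring.
by rewrite !mulf_neq0 // gt_eqF.
Qed.

Lemma exists_psi : exists P1 P2 : V -> R, [/\
  forall p, differentiable P1 p /\ differentiable P2 p,
  forall i p, {for p, continuous (fr i P1)} /\ {for p, continuous (fr i P2)},
  forall p, 0 < P1 p * P1 p + P2 p * P2 p /\ P1 p * fr 2 P2 p - P2 p * fr 2 P1 p != 0 &
  forall g, G g -> exists a c s : R, [/\ a * a + c * c = 1, s * s = 1,
    forall n k p, (n < 3)%N -> (k < 3)%N -> fmat g n k p = plane_rotation a c s n k &
    forall p, P1 p = (a * a - c * c) * P1 (g p) + 2 * a * c * P2 (g p) /\
      P2 p = s * (- (2 * a * c) * P1 (g p) + (a * a - c * c) * P2 (g p))]].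
Proof.
have [sf _ _] := f_leg.
have /choice[L HL] : forall p, exists UF : set V * (V -> V), UF.1 p /\ local_lift f UF.1 UF.2.
  by move=> p; have [U [F [Up lF]]] := sf p; exists (U, F).
pose P1 p := psi1 (L p).2 p; pose P2 p := psi2 (L p).2 p.
(* The transformation rule for the identity ([a = 1], [c = 0], [s = 1]) shows independence of the
   lift, so the pointwise choice [L] still gives functions that agree locally with those of a single
   lift. *)
have loc U F p : local_lift f U F -> U p -> P1 p = psi1 F p /\ P2 p = psi2 F p.
  move=> lF Up; have [Up' lL] := HL p.
  have := psi_transform (g := id) lL lF (transf_id G) Up' Up (mulr1 1) (@fmat_id R).
  rewrite -/(P1 p) -/(P2 p) => -[-> ->]; split; ring.
have near1 p : \forall q \near p, psi1 (L p).2 q = P1 q /\ psi2 (L p).2 q = P2 q.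
  have [Up lL] := HL p; have [oU _ _] := lL.
  apply: filterS (open_nbhs_nbhs (conj oU Up)) => q Uq.
  by have [-> ->] := loc _ _ _ lL Uq.
have n1 p : \forall q \near p, psi1 (L p).2 q = P1 q by apply: filterS (near1 p) => q [].
have n2 p : \forall q \near p, psi2 (L p).2 q = P2 q by apply: filterS (near1 p) => q [].
have frn1 i p : \forall q \near p, fr i (psi1 (L p).2) q = fr i P1 q.
  by apply: filterS (near_join (n1 p)) => q; exact: fr_near.
have frn2 i p : \forall q \near p, fr i (psi2 (L p).2) q = fr i P2 q.
  by apply: filterS (near_join (n2 p)) => q; exact: fr_near.
exists P1, P2; split.
- move=> p; have [Up lL] := HL p; have [d1 d2] := differentiable_psi lL Up.
  by split; [exact: near_eq_differentiable (n1 p) d1|exact: near_eq_differentiable (n2 p) d2].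
- move=> i p; have [Up lL] := HL p; have [c1 c2] := continuous_fr_psi i lL Up.
  by split; [exact: near_eq_continuous (frn1 i p) c1|exact: near_eq_continuous (frn2 i p) c2].
- move=> p; have [Up lL] := HL p; have := psi_nondegenerate lL Up.
  by rewrite (nbhs_singleton (frn1 2%N p)) (nbhs_singleton (frn2 2%N p)).
- move=> g Gg; have [a [c [s [ac ss gE]]]] := group_rotation Gg.
  exists a, c, s; split => // p; have [Up lL] := HL p; have [Up' lL'] := HL (g p).
  exact: psi_transform lL lL' Gg Up Up' ss gE.
Qed.

End Lifts.

(** * The angle function *)

Section Angle.
Variable R : realType.

Lemma is_derive_comp1 (V : normedModType R) (phi : R -> R) (h : V -> R) (q v : V) (d : R) :
  is_derive (h q) 1 phi d -> differentiable h q ->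
  differentiable (fun x => phi (h x)) q /\ 'D_v (fun x => phi (h x)) q = d * 'D_v h q.
Proof.
move=> [dphi <-] dh; have dphi' : differentiable phi (h q) by exact/derivable1_diffP.
have dc : differentiable (phi \o h) q by exact: differentiable_comp.
split=> //; rewrite -[LHS]/('D_v (phi \o h) q) (deriveE _ dc) diff_comp //= (deriveE _ dh).
rewrite (deriv1E dphi) derive1E mulrC; exact.
Qed.

(** [T] is the signed angle from [(u1, u2)] to [(w1, w2)], acute because the dot product is
    positive. Its derivative splits into two angular velocities since the squares of cross and dot
    product add up to the product of the squared lengths. *)
Lemma is_derive_angle (V : normedModType R) (u1 u2 w1 w2 : V -> R) (q v : V) :
  differentiable u1 q -> differentiable u2 q -> differentiable w1 q -> differentiable w2 q ->
  0 < u1 q * w1 q + u2 q * w2 q ->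
  let T := fun x => atan ((u1 x * w2 x - u2 x * w1 x) * (u1 x * w1 x + u2 x * w2 x)^-1) in
  differentiable T q /\
  'D_v T q = (w1 q * 'D_v w2 q - w2 q * 'D_v w1 q) / (w1 q * w1 q + w2 q * w2 q)
    - (u1 q * 'D_v u2 q - u2 q * 'D_v u1 q) / (u1 q * u1 q + u2 q * u2 q).
Proof.
move=> du1 du2 dw1 dw2 pos T.
pose c x := u1 x * w2 x - u2 x * w1 x; pose d x := u1 x * w1 x + u2 x * w2 x.
have dc : differentiable c q.
  apply: (@differentiableB _ _ _ (fun x => u1 x * w2 x) (fun x => u2 x * w1 x));
    exact: differentiableM.
have dd : differentiable d q.
  apply: (@differentiableD _ _ _ (fun x => u1 x * w1 x) (fun x => u2 x * w2 x));
    exact: differentiableM.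
have D (h : V -> R) : differentiable h q -> is_derive q v h ('D_v h q).
  by move=> dh; exact: differentiable_derivable.
have Dc : 'D_v c q = ('D_v u1 q * w2 q + u1 q * 'D_v w2 q) - ('D_v u2 q * w1 q + u2 q * 'D_v w1 q).
  have H := is_derive_sub (is_derive_mul (D _ du1) (D _ dw2)) (is_derive_mul (D _ du2) (D _ dw1)).
  by have [_ ->] := H.
have Dd : 'D_v d q = ('D_v u1 q * w1 q + u1 q * 'D_v w1 q) + ('D_v u2 q * w2 q + u2 q * 'D_v w2 q).
  have H := is_derive_add (is_derive_mul (D _ du1) (D _ dw1)) (is_derive_mul (D _ du2) (D _ dw2)).
  by have [_ ->] := H.
have d0 : d q != 0 by rewrite gt_eqF.
have inv : is_derive (d q) 1 (fun x : R => x^-1) (- (d q) ^- 2).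
  by apply: is_derive_eq (is_deriveV (f := id) d0 (is_derive_id _ _)) _; rewrite [_ *: _]mulr1.
have [di Di] := is_derive_comp1 v inv dd.
have dh : differentiable (fun x => c x * (d x)^-1) q by exact: differentiableM.
have Dh : 'D_v (fun x => c x * (d x)^-1) q = 'D_v c q * (d q)^-1 + c q * (- (d q) ^- 2 * 'D_v d q).
  by have [_ ->] := is_derive_mul (D _ dc) (D _ di); rewrite Di.
have [dT DT] := is_derive_comp1 v (is_derive1_atan (c q * (d q)^-1)) dh.
split; first exact: dT.
apply: etrans DT _; rewrite Dh Dc Dd.
move: pos d0; rewrite /c /d.
move: (u1 q) (u2 q) (w1 q) (w2 q) ('D_v u1 q) ('D_v u2 q) ('D_v w1 q) ('D_v w2 q).
move=> a1 a2 b1 b2 a1' a2' b1' b2' pos d0.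
have sq2 (x y : R) : x * x + y * y = 0 -> x = 0 /\ y = 0.
  move=> /eqP; rewrite -!expr2 paddr_eq0 ?sqr_ge0 // !sqrf_eq0.
  by move=> /andP[/eqP -> /eqP ->].
have a0 : a1 * a1 + a2 * a2 != 0.
  by apply: contra_neq d0 => /sq2[-> ->]; rewrite !mul0r addr0.
have b0 : b1 * b1 + b2 * b2 != 0.
  by apply: contra_neq d0 => /sq2[-> ->]; rewrite !mulr0 addr0.
have lhs (x y x' y' : R) : y != 0 -> y * y + x * x != 0 ->
    (1 + (x * y^-1) ^+ 2)^-1 * (x' * y^-1 + x * (- y ^- 2 * y')) =
    (x' * y - x * y') / (y * y + x * x).
  move=> dn en; rewrite (_ : 1 + (x * y^-1) ^+ 2 = (y * y + x * x) / (y * y)).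
    by field; rewrite dn /= en.
  by field; rewrite dn.
have E : (a1 * b1 + a2 * b2) * (a1 * b1 + a2 * b2) +
   (a1 * b2 - a2 * b1) * (a1 * b2 - a2 * b1) =
   (a1 * a1 + a2 * a2) * (b1 * b1 + b2 * b2) by ring.
rewrite lhs //; last by rewrite E mulf_neq0.
rewrite E.
have -> : (a1' * b2 + a1 * b2' - (a2' * b1 + a2 * b1')) * (a1 * b1 + a2 * b2) -
   (a1 * b2 - a2 * b1) * (a1' * b1 + a1 * b1' + (a2' * b2 + a2 * b2')) =
   (b1 * b2' - b2 * b1') * (a1 * a1 + a2 * a2) -
   (a1 * a2' - a2 * a1') * (b1 * b1 + b2 * b2) by ring.
by field; rewrite a0 b0.
Qed.

Section Ball.
Local Notation V := 'rV[R]_3.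
Variables P1 P2 : V -> R.
Hypotheses (dP : forall p, differentiable P1 p /\ differentiable P2 p)
  (P0 : forall p, 0 < P1 p * P1 p + P2 p * P2 p).

Let box r : set V := [set q | forall i, `[- r, r]%classic (q 0 i)].

Lemma continuous_scale_comp (P : V -> R) : continuous P ->
  continuous (fun x : R * V => P (x.1 *: x.2)).
Proof.
move=> cP x; apply: (@continuous_comp _ _ _ (fun x : R * V => x.1 *: x.2) P); last exact: cP.
by apply: cvgZ; [exact: cvg_fst|exact: cvg_snd].
Qed.

(** At step 0 the dot product is a squared length, hence positive; compactness of the parameters
    [(t, q)] gives one step [1 / n.+1] that keeps it positive everywhere. *)
Lemma subdivision (r : R) : exists n : nat, forall q k, box r q -> (k < n.+1)%N ->
  0 < P1 ((k%:R / n.+1%:R) *: q) * P1 ((k.+1%:R / n.+1%:R) *: q) +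
      P2 ((k%:R / n.+1%:R) *: q) * P2 ((k.+1%:R / n.+1%:R) *: q).
Proof.
have c1 : continuous P1 by move=> p; apply: differentiable_continuous; have [] := dP p.
have c2 : continuous P2 by move=> p; apply: differentiable_continuous; have [] := dP p.
pose K : set (R * V) := `[0, 1]%classic `*` box r.
have cK : compact K.
  apply: compact_setX; first exact: segment_compact.
  by apply: (@rV_compact R 3 (fun=> `[- r, r]%classic)) => i; exact: segment_compact.
pose S (d : R) (x : R * V) := 0 < P1 (x.1 *: x.2) * P1 ((x.1 + d) *: x.2) +
   P2 (x.1 *: x.2) * P2 ((x.1 + d) *: x.2).
have cv : \forall d \near (0 : R), K `<=` S d.
  apply: ((compact_near_coveringP K).1 cK R (nbhs (0 : R)) S _) => x Kx.
  pose h (y : (R * V) * R) := P1 (y.1.1 *: y.1.2) * P1 ((y.1.1 + y.2) *: y.1.2) +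
     P2 (y.1.1 *: y.1.2) * P2 ((y.1.1 + y.2) *: y.1.2).
  have ch : {for (x, 0), continuous h}.
    have part (P : V -> R) : continuous P ->
       {for (x, 0), continuous (fun y : (R * V) * R => P (y.1.1 *: y.1.2))} /\
       {for (x, 0), continuous (fun y : (R * V) * R => P ((y.1.1 + y.2) *: y.1.2))}.
      move=> cP; split.
        apply: (@continuous_comp _ _ _ fst (fun x : R * V => P (x.1 *: x.2))).
          exact: cvg_fst.
        exact: continuous_scale_comp.
      apply: (@continuous_comp _ _ _ (fun y : (R * V) * R => (y.1.1 + y.2) *: y.1.2) P).
        apply: cvgZ; first apply: cvgD.
        - by apply: (@cvg_comp _ _ _ fst fst); [exact: cvg_fst|exact: cvg_fst].
        - exact: cvg_snd.
        - by apply: (@cvg_comp _ _ _ fst snd); [exact: cvg_fst|exact: cvg_snd].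
      exact: cP.
    have [p1 p2] := part P1 c1; have [p3 p4] := part P2 c2.
    exact (continuous_add (continuous_mul p1 p2) (continuous_mul p3 p4)).
  have h0 : 0 < h (x, 0) by rewrite /h /= addr0; exact: P0.
  have n0 : nbhs (h (x, 0)) [set y : R | 0 < y] by exact: (@lt_nbhsr R 0 (h (x, 0))).
  exact: (ch _ n0).
have [n nK] : exists n, K `<=` S n.+1%:R^-1.
  have n0 := @cvg_harmonic R _ cv.
  by have [n _ /(_ n (leqnn n))] := n0; exists n.
exists n => q k qr kn.
have n1 : 0 < n.+1%:R :> R by rewrite ltr0n.
have := nK (k%:R / n.+1%:R, q); rewrite /S /=.
have -> : k%:R / n.+1%:R + n.+1%:R^-1 = k.+1%:R / n.+1%:R :> R.
  by rewrite -[k.+1%:R]natr1 mulrDl mul1r.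
apply; split => //=; rewrite in_itv /= divr_ge0 //= ler_pdivrMr // mul1r ler_nat.
exact: ltnW.
Qed.

Lemma derive_scale (P : V -> R) (c : R) q v : (forall p, differentiable P p) ->
  differentiable (fun x => P (c *: x)) q /\
  'D_v (fun x => P (c *: x)) q = c * 'D_v P (c *: q).
Proof.
move=> dP'.
have ds : differentiable (fun x : V => c *: x) q by exact: (@differentiableZ _ _ _ id).
have dc : differentiable (fun x => P (c *: x)) q.
  exact: (@differentiable_comp _ _ _ _ (fun x : V => c *: x) P).
split=> //; rewrite (deriveE _ dc) (@diff_comp _ _ _ _ (fun x : V => c *: x) P) //=.
have Ds : 'D_v (fun x : V => c *: x) q = c *: v.
  by rewrite (@deriveZ _ _ _ id) ?derive_id //; exact: derivable_id.
by rewrite -(deriveE v ds) Ds linearZ /= deriveE.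
Qed.

Lemma angle_on_box (r : R) : exists theta : V -> R, forall q, box r q ->
  differentiable theta q /\ forall v, 'D_v theta q =
    (P1 q * 'D_v P2 q - P2 q * 'D_v P1 q) / (P1 q * P1 q + P2 q * P2 q).
Proof.
(* Sum the angle increments along a subdivision of the ray from 0 to [q]; differentiation
   telescopes the sum. *)
have [n Hn] := subdivision r.
pose c (k : nat) : R := k%:R / n.+1%:R.
pose u (k : nat) x := P1 (c k *: x); pose w (k : nat) x := P2 (c k *: x).
pose T k := fun x => atan ((u k x * w k.+1 x - w k x * u k.+1 x) *
   (u k x * u k.+1 x + w k x * w k.+1 x)^-1).
pose W v k q := (u k q * 'D_v (w k) q - w k q * 'D_v (u k) q) / (u k q * u k q + w k q * w k q).
exists (fun q => \sum_(0 <= k < n.+1) T k q) => q qr.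
have dP1 p : differentiable P1 p by have [] := dP p.
have dP2 p : differentiable P2 p by have [] := dP p.
have du k : differentiable (u k) q by have [] := derive_scale (c k) q 0 dP1.
have dw k : differentiable (w k) q by have [] := derive_scale (c k) q 0 dP2.
have dT k v : (k < n.+1)%N -> differentiable (T k) q /\ 'D_v (T k) q = W v k.+1 q - W v k q.
  move=> kn; exact: (is_derive_angle v (du _) (dw _) (du _) (dw _) (Hn q k qr kn)).
have sum m : (m <= n.+1)%N -> differentiable (fun q => \sum_(0 <= k < m) T k q) q /\
    forall v, 'D_v (fun q => \sum_(0 <= k < m) T k q) q = W v m q - W v 0%N q.
  elim: m => [|m IH] mn.
    have -> : (fun q => \sum_(0 <= k < 0) T k q) = cst 0 by apply/funext => x; rewrite big_nil.
    by split=> [|v]; [exact: differentiable_cst|rewrite derive_cst subrr].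
  have [d1 D1] := IH (ltnW mn).
  have -> : (fun q => \sum_(0 <= k < m.+1) T k q) =
      fun q => \sum_(0 <= k < m) T k q + T m q by apply/funext => x; rewrite big_nat_recr.
  split=> [|v]; first by apply: differentiableD => //; have [] := dT m 0 mn.
  have [d2 D2] := dT m v mn.
  have [_ ->] := is_derive_add (differentiable_derivable v d1) (differentiable_derivable v d2).
  by rewrite D1 D2; ring.
have [d1 D1] := sum n.+1 (leqnn _); split=> // v; rewrite D1.
have cn : c n.+1 = 1 by rewrite /c divff // pnatr_eq0.
have c0 : c 0%N = 0 by rewrite /c mul0r.
have un : u n.+1 = P1 by apply/funext => x; rewrite /u cn scale1r.
have wn : w n.+1 = P2 by apply/funext => x; rewrite /w cn scale1r.
(* All rays start at the origin, so the initial term of the telescoping sum has zero derivative. *)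
have u0 : u 0%N = cst (P1 0) by apply/funext => x; rewrite /u c0 scale0r.
have w0 : w 0%N = cst (P2 0) by apply/funext => x; rewrite /w c0 scale0r.
by rewrite /W un wn u0 w0 !derive_cst !mulr0 subrr mul0r subr0.
Qed.

End Ball.
End Angle.

(** * Bounds from compactness and the growth estimate *)

Section OrbitBound.
Variables (R : realType).
Local Notation V := 'rV[R]_3.

Lemma norm_le_of_sqr (t C : R) : 0 <= C -> t * t <= C -> `|t| <= C + 1.
Proof.
move=> C0 tC; rewrite leNgt; apply/negP => h.
have : (C + 1) * (C + 1) < `|t| * `|t| by apply: ltr_pM => //; lra.
rewrite -normrM [`|t * t|]ger0_norm -?expr2 ?sqr_ge0 // expr2 => h2.
have := mulr_ge0 C0 C0; rewrite expr2 in h2; nra.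
Qed.

(** An invariant [H] descends to [H \o repr], which is continuous for the quotient topology even
    where [repr] is not, and so attains a maximum. *)
Lemma compact_orbit_bounded (G : transf_group V) (H : V -> R) :
  compact [set: orbit_space G] -> continuous H ->
  (forall g q, G g -> H (g q) = H q) -> exists C, forall q, H q <= C.
Proof.
move=> cM cH inv.
pose Q0 := {eq_quot (orbit_equiv G)}%qT.
have inv' : {homo H : a b / (\pi_(quotient_topology Q0) a == \pi b)%qT >-> a == b}.
  move=> a b /eqP /(orbit_piP G _ _)[g Gg <-]; by rewrite inv.
have cont := repr_comp_continuous cH inv'.
have ne : [set: quotient_topology Q0] !=set0 by exists (orbit_pi G 0).
have cont' : {within [set: quotient_topology Q0], continuous (H \o repr)}.
  exact: continuous_subspaceT.
have [x _ Hx] := compact_EVT_max ne cM cont'.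
exists (H (repr x)) => q.
have := Hx (orbit_pi G q) (in_setT _).
rewrite /= (eqP (inv' (repr (orbit_pi G q)) q _)) //.
by rewrite /orbit_pi reprK.
Qed.

Section Contradiction.
Variables P1 P2 : V -> R.
Hypothesis dP : forall p, differentiable P1 p /\ differentiable P2 p.

(** Dividing by [sqn] gives the derivative of the angle of [(P1, P2)] along the [i]-th frame
    field. *)
Definition wedge (i : nat) (q : V) : R := P1 q * fr i P2 q - P2 q * fr i P1 q.
Definition sqn (q : V) : R := P1 q * P1 q + P2 q * P2 q.

Hypothesis sqn_gt0 : forall p, 0 < sqn p.

Lemma angle_growth_contradiction (C : R) : 0 <= C ->
  (forall q, `|wedge 0 q / sqn q| <= C) -> (forall q, `|wedge 1 q / sqn q| <= C) ->
  (forall q, `|sqn q / wedge 2 q| <= C) -> (forall q, wedge 2 q != 0) -> False.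
Proof.
move=> C0 b0 b1 b2 nz.
(* The angle gained vertically is at least [s * s / C] and at most [4 * C * s], which forces
   [s <= 4 * C * C]. *)
pose s := 4 * C * C + 1; have s1 : 1 <= s by rewrite /s; have := mulr_ge0 C0 C0; lra.
have ss : s <= s * s by rewrite -{1}[s]mulr1 ler_wpM2l // (le_trans ler01 s1).
have s0 : 0 <= s by apply: le_trans s1.
(* The coordinates along the path are at most [s * s], using [1 <= s] for the horizontal ones. *)
pose r := s * s + 1.
have [theta th] := angle_on_box dP sqn_gt0 r.
have box x y z : `|x| <= s * s -> `|y| <= s * s -> `|z| <= s * s ->
    forall i : 'I_3, `[- r, r]%classic ((vec3 x y z : V) 0 i).
  move=> hx hy hz i; rewrite /= in_itv /= -ler_norml.
  have hr t : `|t| <= s * s -> `|t| <= r by move=> /le_trans; apply; rewrite /r lerDl.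
  by case: i => [[|[|[|//]]] k]; rewrite mxE /=; exact: hr.
have fth i (q : V) : (forall i : 'I_3, `[- r, r]%classic (q 0 i)) -> fr i theta q = wedge i q / sqn q.
  move=> /th[dth Dth]; have [d1 d2] := dP q.
  by rewrite (frE i dth) Dth /wedge (frE i d1) (frE i d2).
have bt t : 0 <= t <= s -> [/\ `|t| <= s * s, `|s| <= s * s & `|s * t| <= s * s].
  move=> /andP[t0 ts]; rewrite !ger0_norm ?mulr_ge0 //; split => //; first exact: le_trans ts ss.
  by rewrite ler_wpM2l.
have z0 : `|0 : R| <= s * s by rewrite normr0 mulr_ge0.
have nss : `|s * s| <= s * s by rewrite ger0_norm // mulr_ge0.
have := @commutator_path_bound R theta [set q : V | forall i : 'I_3, `[- r, r]%classic (q 0 i)]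
   0 0 0 C s s0.
rewrite !add0r => /(_ _ _) path.
have {path} up : `|theta (vec3 0 0 (s * s)) - theta (vec3 0 0 0)| <= 4 * C * s.
  apply: path.
    by move=> q /[dup] /th[dth _] qr; rewrite !fth.
  move=> t /bt[h1 h2 h3]; rewrite !add0r !mul0r !addr0.
  by split; apply: box.
have e t : vec3 0 0 t = vec3 0 0 0 + t *: dZ R.
  by apply: vec3_eq; rewrite !mxE /=; ring.
have [||c cs ez] := @mvt_line _ _ theta (vec3 0 0 0) (dZ R) (fun t => fr 2 theta (vec3 0 0 t)) (s * s).
- exact: mulr_ge0.
- move=> t /andP[t0 ts]; rewrite -e.
  have [] := th (vec3 0 0 t); first by apply: box => //; rewrite ger0_norm.
  by move=> dth _; apply: (is_fr 2 dth).
rewrite -e in ez; rewrite ez fth in up; last first.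
  by apply: box => //; have /andP[c0 cs'] := cs; rewrite ger0_norm.
move: up; set q := vec3 0 0 c; rewrite normrM [`|s * s|]ger0_norm ?mulr_ge0 //.
have w : `|wedge 2 q / sqn q| * `|sqn q / wedge 2 q| = 1.
  have Q0 : sqn q != 0 by rewrite gt_eqF.
  by rewrite -normrM mulrA divfK // divff // normr1.
move=> up.
have h1 : s * s <= C * (4 * C * s).
  have -> : s * s = `|sqn q / wedge 2 q| * (`|wedge 2 q / sqn q| * (s * s)).
    by rewrite [RHS]mulrA [`|sqn _ / _| * _]mulrC w mul1r.
  apply: ler_pM; [exact: normr_ge0|by rewrite !mulr_ge0|exact: b2|exact: up].
have : s * s <= (4 * C * C) * s by apply: le_trans h1 _; rewrite le_eqVlt; apply/orP; left; apply/eqP; ring.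
rewrite ler_pM2r; last by apply: lt_le_trans s1.
rewrite /s; lra.
Qed.

End Contradiction.
End OrbitBound.

(** * Behaviour of the angle form under the group *)

Section Invariance.
Variables (R : realType) (P1 P2 : 'rV[R]_3 -> R) (g : 'rV[R]_3 -> 'rV[R]_3) (a c s : R).
Hypotheses (dP : forall p, differentiable P1 p /\ differentiable P2 p)
  (dg : forall p, differentiable g p) (ac : a * a + c * c = 1) (ss : s * s = 1)
  (gE : forall n k p, (n < 3)%N -> (k < 3)%N -> fmat g n k p = plane_rotation a c s n k)
  (gP : forall p, P1 p = (a * a - c * c) * P1 (g p) + 2 * a * c * P2 (g p) /\
      P2 p = s * (- (2 * a * c) * P1 (g p) + (a * a - c * c) * P2 (g p))).

Lemma sqn_invariant q : sqn P1 P2 q = sqn P1 P2 (g q).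
Proof.
rewrite /sqn; have [-> ->] := gP q; move: (P1 (g q)) (P2 (g q)) => x y.
transitivity (((a * a + c * c) * (a * a + c * c)) * (x * x + y * y) +
  (s * s - 1) * ((- (2 * a * c) * x + (a * a - c * c) * y) *
   (- (2 * a * c) * x + (a * a - c * c) * y))); first by ring.
by rewrite ac ss; ring.
Qed.

(** [wedge] is a determinant, and [(P1, P2)] is obtained from its composite with [g] by a constant
    matrix of determinant [s]; the chain rule contributes the matrix of [g] in the frames. *)
Lemma wedge_transform i q : (i < 3)%N -> wedge P1 P2 i q =
  s * (wedge P1 P2 0 (g q) * plane_rotation a c s 0 i +
       wedge P1 P2 1 (g q) * plane_rotation a c s 1 i +
       wedge P1 P2 2 (g q) * plane_rotation a c s 2 i).
Proof.
move=> i3.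
have dc (P : 'rV[R]_3 -> R) : (forall p, differentiable P p) -> differentiable (fun x => P (g x)) q.
  by move=> dP'; exact: (@differentiable_comp _ _ _ _ g P).
have d1 p : differentiable P1 p by have [] := dP p.
have d2 p : differentiable P2 p by have [] := dP p.
have lin (k1 k2 : R) : fr i (fun x => k1 * P1 (g x) + k2 * P2 (g x)) q =
    k1 * fr i (fun x => P1 (g x)) q + k2 * fr i (fun x => P2 (g x)) q.
  have k0 k : fr i (fun=> k : R) q = 0 by apply: fr_eq; exact: differentiable_cst.
  have m k (P : 'rV[R]_3 -> R) : differentiable P q -> differentiable (fun x => k * P x) q /\
      fr i (fun x => k * P x) q = k * fr i P q.
    move=> dP'; split.
      exact: (@differentiableM _ _ (fun=> k) P).
    by rewrite (frM i (differentiable_cst k q) dP') k0 mul0r add0r.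
  have [m1 e1] := m k1 _ (dc _ d1); have [m2 e2] := m k2 _ (dc _ d2).
  by rewrite (frD i m1 m2) e1 e2.
have E1 : P1 = fun x => (a * a - c * c) * P1 (g x) + 2 * a * c * P2 (g x).
  by apply/funext => x; have [] := gP x.
have E2 : P2 = fun x => (- (s * (2 * a * c))) * P1 (g x) + (s * (a * a - c * c)) * P2 (g x).
  by apply/funext => x; have [_ e] := gP x; rewrite [LHS]e; ring.
have F1 : fr i P1 q = (a * a - c * c) * fr i (fun x => P1 (g x)) q +
    2 * a * c * fr i (fun x => P2 (g x)) q by rewrite -lin; congr (fr i _ q).
have F2 : fr i P2 q = (- (s * (2 * a * c))) * fr i (fun x => P1 (g x)) q +
    (s * (a * a - c * c)) * fr i (fun x => P2 (g x)) q by rewrite -lin; congr (fr i _ q).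
rewrite {1}/wedge F1 F2; have [-> ->] := gP q.
rewrite (fr_comp i (d1 _) (dg q)) (fr_comp i (d2 _) (dg q)) !gE //.
rewrite /wedge.
move: (plane_rotation a c s 0 i) (plane_rotation a c s 1 i) (plane_rotation a c s 2 i) => r0 r1 r2.
move: (P1 (g q)) (P2 (g q)) => x y.
move: (fr 0 P1 (g q)) (fr 1 P1 (g q)) (fr 2 P1 (g q)) => x0 x1 x2.
move: (fr 0 P2 (g q)) (fr 1 P2 (g q)) (fr 2 P2 (g q)) => y0 y1 y2.
transitivity (s * ((a * a + c * c) * (a * a + c * c)) *
  (x * (y0 * r0 + y1 * r1 + y2 * r2) - y * (x0 * r0 + x1 * r1 + x2 * r2))); first by ring.
by rewrite ac; ring.
Qed.

(* [(X theta)^2 + (Y theta)^2 + (Z theta)^-2] for the angle [theta] of [(P1, P2)]. *)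
Definition slope (q : 'rV[R]_3) : R :=
  (wedge P1 P2 0 q * wedge P1 P2 0 q + wedge P1 P2 1 q * wedge P1 P2 1 q) *
    (sqn P1 P2 q * sqn P1 P2 q)^-1 +
  sqn P1 P2 q * sqn P1 P2 q * (wedge P1 P2 2 q * wedge P1 P2 2 q)^-1.

Lemma slope_invariant q : slope (g q) = slope q.
Proof.
rewrite /slope -sqn_invariant !(@wedge_transform _ q) //=.
move: (wedge P1 P2 0 (g q)) (wedge P1 P2 1 (g q)) (wedge P1 P2 2 (g q)) => x y z.
congr (_ * _ + _ * _^-1).
  transitivity (s * s * ((a * a + c * c) * (x * x) + (a * a + c * c) * (y * y)) +
    (s * s * (s * s) - s * s) * ((x * - c + y * a) * (x * - c + y * a))); last by ring.
  by rewrite ss ac; ring.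
transitivity ((s * s) * (s * s) * (z * z)); last by ring.
by rewrite ss !mul1r.
Qed.

End Invariance.

Theorem mainTheorem4 (R : realType) (G : transf_group 'rV[R]_3)
    (G_isom : forall g, G g -> nil_isometry g)
    (G_orient : forall g, G g -> orientation_preserving g)
    (G_discrete : discrete_group G)
    (G_free : acts_freely G)
    (M_closed : compact [set: orbit_space G])
    (f : orbit_space G -> orbit_space G)
    (f_legendrian : legendrian f) :
  ~ diffeomorphism f.
Proof.
move=> f_diff.
have [P1 [P2 [dP cP nd tr]]] := exists_psi G_isom G_orient G_discrete G_free f_legendrian f_diff.
have sqn0 p : 0 < sqn P1 P2 p by have [] := nd p.
have w2 p : wedge P1 P2 2 p != 0 by have [] := nd p.
have cP1 p : {for p, continuous P1} by apply: differentiable_continuous; have [] := dP p.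
have cP2 p : {for p, continuous P2} by apply: differentiable_continuous; have [] := dP p.
have cw i p : {for p, continuous (wedge P1 P2 i)}.
  have [f1 f2] := cP i p.
  exact (continuous_sub (continuous_mul (cP1 p) f2) (continuous_mul (cP2 p) f1)).
have cs p : {for p, continuous (sqn P1 P2)}.
  exact (continuous_add (continuous_mul (cP1 p) (cP1 p)) (continuous_mul (cP2 p) (cP2 p))).
(* [slope] collects three squares in one invariant continuous function, so a single bound on the
   compact quotient controls each of them. *)
have [C HC] : exists C, forall q, slope P1 P2 q <= C.
  apply: (compact_orbit_bounded M_closed).
    move=> p; have inv (h : 'rV[R]_3 -> R) : h p != 0 -> {for p, continuous h} ->
      {for p, continuous (fun q => (h q)^-1)} by exact: continuousV.
    have ss := continuous_mul (cs p) (cs p).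
    have ww i := continuous_mul (cw i p) (cw i p).
    have i1 : {for p, continuous (fun q => (sqn P1 P2 q * sqn P1 P2 q)^-1)}.
      by apply: (inv (fun q => sqn P1 P2 q * sqn P1 P2 q)) => //; rewrite mulf_neq0 // gt_eqF.
    have i2 : {for p, continuous (fun q => (wedge P1 P2 2 q * wedge P1 P2 2 q)^-1)}.
      by apply: (inv (fun q => wedge P1 P2 2 q * wedge P1 P2 2 q)) => //; rewrite mulf_neq0.
    exact (continuous_add (continuous_mul (continuous_add (ww 0) (ww 1%N)) i1)
      (continuous_mul ss i2)).
  move=> g q Gg; have [a [c [s [ac ss gE gP]]]] := tr g Gg.
  exact: slope_invariant dP (isometry_differentiable (G_isom _ Gg)) ac ss gE gP q.
have parts q : [/\ wedge P1 P2 0 q / sqn P1 P2 q * (wedge P1 P2 0 q / sqn P1 P2 q) <= C,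
    wedge P1 P2 1 q / sqn P1 P2 q * (wedge P1 P2 1 q / sqn P1 P2 q) <= C &
    sqn P1 P2 q / wedge P1 P2 2 q * (sqn P1 P2 q / wedge P1 P2 2 q) <= C].
  have := HC q; rewrite /slope !invfM.
  move: (wedge P1 P2 0 q) (wedge P1 P2 1 q) (sqn P1 P2 q) (sqn P1 P2 q)^-1 (wedge P1 P2 2 q)^-1.
  move=> x y t u v H.
  have h0 := sqr_ge0 (x * u); have h1 := sqr_ge0 (y * u); have h2 := sqr_ge0 (t * v).
  rewrite !expr2 in h0 h1 h2.
  have E : (x * x + y * y) * (u * u) + t * t * (v * v) =
    x * u * (x * u) + y * u * (y * u) + t * v * (t * v) by ring.
  by rewrite E in H; split; lra.
have C0 : 0 <= C by have [_ _ h] := parts 0; apply: le_trans h; rewrite -expr2 sqr_ge0.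
apply: (@angle_growth_contradiction R P1 P2 dP sqn0 (C + 1)) => //.
- by rewrite addr_ge0.
- by move=> q; have [h _ _] := parts q; exact: norm_le_of_sqr.
- by move=> q; have [_ h _] := parts q; exact: norm_le_of_sqr.
- by move=> q; have [_ _ h] := parts q; exact: norm_le_of_sqr.
Qed.
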